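(* Let $\mathbb{T}$ be a bounded time scale with at least three points such that $\rho$ is $\Delta$-differentiable on $\mathbb{T}^\kappa$ and $\sigma$ is $\nabla$-differentiable on $\mathbb{T}_\kappa$. Let $d\ge 1$ and let $X=\begin{pmatrix}X_q \\ X_p\end{pmatrix}$ with $X_q,X_p:\mathbb{R}^d\times\mathbb{R}^d\to\mathbb{R}^d$ of class $C^1$. Then $X$ is a time scale Hamiltonian vector field if and only if the operator $O^{\mathbb{T}}_X$ associated with $X$ has its Fréchet derivative self-adjoint (at every $(q,p)\in C^{1,\Delta\times\nabla}(\mathbb{T},\mathbb{R}^d)$) with respect to the $L^2$-$\Delta$ symplectic scalar product. In this case, a Hamiltonian associated to $X$ is given by $$H(q,p)=\int_0^1\left[p\cdot X_q(\lambda q,\lambda p)-q\cdot X_p(\lambda q,\lambda p)\right]d\lambda .$$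
   Context: A bounded time scale is a nonempty compact subset $\mathbb{T}\subset\mathbb{R}$; $a=\min\mathbb{T}$, $b=\max\mathbb{T}$, $\mathrm{card}(\mathbb{T})\ge 3$. Jump operators $\rho,\sigma:\mathbb{T}\to\mathbb{T}$: $\rho(t)=\sup\{s\in\mathbb{T}: s<t\}$, $\sigma(t)=\inf\{s\in\mathbb{T}: s>t\}$, with $\sup\emptyset=a$, $\inf\emptyset=b$. A point $t$ is left-dense if $\rho(t)=t$ and right-dense if $\sigma(t)=t$. Set $\mathbb{T}^\kappa=\mathbb{T}\setminus\,]\rho(b),b]$, $\mathbb{T}_\kappa=\mathbb{T}\setminus[a,\sigma(a)[$, $\mathbb{T}^\kappa_\kappa=\mathbb{T}^\kappa\cap\mathbb{T}_\kappa$. For $u:\mathbb{T}\to\mathbb{R}^n$: the $\Delta$-derivative at $t\in\mathbb{T}^\kappa$ is $u^\Delta(t)=\lim_{s\to t,\,s\neq\sigma(t)}\frac{u(\sigma(t))-u(s)}{\sigma(t)-s}$, and the $\nabla$-derivative at $t\in\mathbb{T}_\kappa$ is $u^\nabla(t)=\lim_{s\to t,\,s\ne\rho(t)}\frac{u(s)-u(\rho(t))}{s-\rho(t)}$ ($s\in\mathbb{T}$), when these limits exist. A function is rd-continuous if it is continuous at right-dense points and has a left-sided limit at left-dense points; ld-continuous if it is continuous at left-dense points and has a right-sided limit at right-dense points. $C^{1,\Delta}_{\mathrm{rd}}(\mathbb{T},\mathbb{R}^d)$: functions $\mathbb{T}\to\mathbb{R}^d$ that are $\Delta$-differentiable on $\mathbb{T}^\kappa$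 with rd-continuous $\Delta$-derivative; $C^{1,\nabla}_{\mathrm{ld}}(\mathbb{T},\mathbb{R}^d)$: functions $\nabla$-differentiable on $\mathbb{T}_\kappa$ with ld-continuous $\nabla$-derivative. $C^{1,\Delta\times\nabla}(\mathbb{T},\mathbb{R}^d)=C^{1,\Delta}_{\mathrm{rd}}(\mathbb{T},\mathbb{R}^d)\times C^{1,\nabla}_{\mathrm{ld}}(\mathbb{T},\mathbb{R}^d)$, and $C^{1,\Delta\times\nabla}_0(\mathbb{T},\mathbb{R}^d)$ is the subset of pairs $(u,v)$ with $u,v$ vanishing at $a$ and $b$. The $\Delta$-integral is the Cauchy integral: $\int_a^b f(t)\,\Delta t=F(b)-F(a)$ where $F^\Delta=f$ on $\mathbb{T}^\kappa$. Symplectic scalar product: with $J=\begin{pmatrix}0&I_d\\-I_d&0\end{pmatrix}$, $\langle f,g\rangle_{L^2,\Delta,J}=\int_a^b\langle f(t),J g(t)\rangle\,\Delta t$ for $\mathbb{R}^{2d}$-valued $f,g$ on $\mathbb{T}$; when $f$ is only defined on $\mathbb{T}^\kappa_\kappa$ and $g$ vanishes at $a$, the integrand is taken to be $0$ at $a$ if $a\notin\mathbb{T}_\kappa$. The operator associated with $X$ maps $(q,p)\in C^{1,\Delta\times\nabla}(\mathbb{T},\mathbb{R}^d)$ to the $\mathbb{R}^{2d}$-valued function on $\mathbb{T}^\kappa_\kappa$ $$O^{\mathbb{T}}_X(q,p)=\begin{pmatrix}q^\Delta-X_q(q,p)\\ \rho^\Delta p^\nabla-X_p(q,p)\end{pmatrix}.$$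 Its Fréchet derivative at $(q,p)$ along $(u,v)\in C^{1,\Delta\times\nabla}_0(\mathbb{T},\mathbb{R}^d)$ is $DO^{\mathbb{T}}_X(q,p)(u,v)=\frac{d}{d\varepsilon}\big|_{\varepsilon=0}O^{\mathbb{T}}_X(q+\varepsilon u,p+\varepsilon v)$ (pointwise on $\mathbb{T}^\kappa_\kappa$). The adjoint $A^*_J$ of a linear operator $A$ on $C^{1,\Delta\times\nabla}_0(\mathbb{T},\mathbb{R}^d)$ is defined by $\langle A f,g\rangle_{L^2,\Delta,J}=\langle A^*_J g,f\rangle_{L^2,\Delta,J}$ for all $f,g\in C^{1,\Delta\times\nabla}_0(\mathbb{T},\mathbb{R}^d)$; $A$ is self-adjoint if this identity holds with $A^*_J=A$. $X$ is a time scale Hamiltonian vector field if there is a function $H:\mathbb{R}^d\times\mathbb{R}^d\to\mathbb{R}$ (a Hamiltonian associated to $X$) with $X_q=\frac{\partial H}{\partial p}$ and $X_p=-\frac{\partial H}{\partial q}$, i.e. such that the system $q^\Delta=X_q(q,p)$, $\rho^\Delta p^\nabla=X_p(q,p)$ on $\mathbb{T}^\kappa_\kappa$ is the system of time scale Hamilton's equations $q^\Delta=\frac{\partial H}{\partial p}(q,p)$, $\rho^\Delta p^\nabla=-\frac{\partial H}{\partial q}(q,p)$. *)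

(* Defs.v *)
From mathcomp Require Export all_boot all_order all_algebra.
From mathcomp Require Export all_classical all_reals all_analysis.
Export numFieldNormedType.Exports.

Set Implicit Arguments.
Unset Strict Implicit.
Unset Printing Implicit Defensive.

Import Order.TTheory GRing.Theory Num.Theory.
Local Open Scope classical_set_scope.
Local Open Scope ring_scope.

(* Functions on a time scale T are represented by total functions on R; every
   notion below depends only on their values on T. *)

Definition bounded_time_scale (R : realType) (T : set R) : Prop :=
  T !=set0 /\ compact T.

Section TimeScale.
Context {R : realType} (T : set R).

(* The extrema of T are attained, T being nonempty and compact. *)
Definition tmin : R := inf T.
Definition tmax : R := sup T.

Definition rho (t : R) : R :=
  let S := T `&` [set s | s < t] in if S == set0 then tmin else sup S.
Definition sigma (t : R) : R :=
  let S := T `&` [set s | t < s] in if S == set0 then tmax else inf S.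

Definition left_dense (t : R) : Prop := rho t = t.
Definition right_dense (t : R) : Prop := sigma t = t.

Definition kappa_up : set R := T `\` `]rho tmax, tmax].
Definition kappa_dn : set R := T `\` `[tmin, sigma tmin[.
Definition kappa2 : set R := kappa_up `&` kappa_dn.

Section Calculus.
Context {V : normedModType R}.
Implicit Types u f : R -> V.

(* The filter does not exclude s = t when t is scattered, so derivability
   forces continuity there. *)
Definition ddiff (u : R -> V) (t s : R) : V :=
  (sigma t - s)^-1 *: (u (sigma t) - u s).
Definition dfilter (t : R) : set_system R :=
  within (T `&` [set s | s != sigma t]) (nbhs t).
Definition dderivable u t : Prop := cvg (ddiff u t @ dfilter t).
Definition dderive u (t : R) : V := lim (ddiff u t @ dfilter t).

Definition ndiff (u : R -> V) (t s : R) : V :=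
  (s - rho t)^-1 *: (u s - u (rho t)).
Definition nfilter (t : R) : set_system R :=
  within (T `&` [set s | s != rho t]) (nbhs t).
Definition nderivable u t : Prop := cvg (ndiff u t @ nfilter t).
Definition nderive u (t : R) : V := lim (ndiff u t @ nfilter t).

(* D is the subset of T on which f is defined. Convergence along the trivial
   filter holds vacuously, so nothing is required of the left limit at tmin or
   of the right limit at tmax. *)
Definition rd_continuous_on (D : set R) f : Prop :=
  (forall t, D t -> right_dense t -> f @ within D (nbhs t) --> f t) /\
  (forall t, D t -> left_dense t ->
     cvg (f @ within (D `&` [set s | s < t]) (nbhs t))).
Definition ld_continuous_on (D : set R) f : Prop :=
  (forall t, D t -> left_dense t -> f @ within D (nbhs t) --> f t) /\
  (forall t, D t -> right_dense t ->
     cvg (f @ within (D `&` [set s | t < s]) (nbhs t))).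

Definition C1_rd u : Prop :=
  (forall t, kappa_up t -> dderivable u t) /\
  rd_continuous_on kappa_up (dderive u).
Definition C1_ld u : Prop :=
  (forall t, kappa_dn t -> nderivable u t) /\
  ld_continuous_on kappa_dn (nderive u).

End Calculus.

(* [is_dintegral f I]: the Cauchy Delta-integral of f over T exists and is I. *)
Definition is_dintegral (f : R -> R) (I : R) : Prop :=
  exists F : R -> R,
    (forall t, kappa_up t -> dderivable F t /\ dderive F t = f t) /\
    I = F tmax - F tmin.

End TimeScale.

Definition dotp {R : realType} {n : nat} (x y : 'cV[R]_n) : R :=
  (x^T *m y) 0 0.

Definition symplJ (R : realType) (d : nat) : 'M[R]_(d + d) :=
  block_mx 0 1%:M (- 1%:M) 0.

Section Operators.
Context {R : realType} (T : set R) {d : nat}.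

(* Pairs (q, p) of R^d-valued functions. *)
Definition pair_fun : Type := ((R -> 'cV[R]_d) * (R -> 'cV[R]_d))%type.

Definition C1dn (f : pair_fun) : Prop := C1_rd T f.1 /\ C1_ld T f.2.

Definition C1dn0 (f : pair_fun) : Prop :=
  C1dn f /\ [/\ f.1 (tmin T) = 0, f.1 (tmax T) = 0,
                f.2 (tmin T) = 0 & f.2 (tmax T) = 0].

Definition joint (f : pair_fun) (t : R) : 'cV[R]_(d + d) :=
  col_mx (f.1 t) (f.2 t).

(* f is meaningful on kappa2 T only and g vanishes at tmin T: the integrand is
   0 at the point of kappa_up T outside kappa_dn T, which can only be tmin T. *)
Definition is_sympl_prod (f g : R -> 'cV[R]_(d + d)) (I : R) : Prop :=
  is_dintegral T
    (fun t => if t \in kappa_dn T then dotp (f t) (symplJ R d *m g t) else 0) I.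

(* Both symplectic products are required to exist. *)
Definition is_adjoint (A B : pair_fun -> R -> 'cV[R]_(d + d)) : Prop :=
  forall f g : pair_fun, C1dn0 f -> C1dn0 g ->
    exists I : R, is_sympl_prod (A f) (joint g) I /\
                  is_sympl_prod (B g) (joint f) I.

Definition self_adjoint (A : pair_fun -> R -> 'cV[R]_(d + d)) : Prop :=
  is_adjoint A A.

Variables Xq Xp : 'cV[R]_d * 'cV[R]_d -> 'cV[R]_d.

Definition opO (f : pair_fun) (t : R) : 'cV[R]_(d + d) :=
  col_mx (dderive T f.1 t - Xq (f.1 t, f.2 t))
         (dderive T (rho T) t *: nderive T f.2 t - Xp (f.1 t, f.2 t)).

Definition opDO (f h : pair_fun) (t : R) : 'cV[R]_(d + d) :=
  derive1 (fun e : R =>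
    opO (fun s => f.1 s + e *: h.1 s, fun s => f.2 s + e *: h.2 s) t) 0.

End Operators.

Section Hamiltonian.
Context {R : realType} {d : nat}.
Implicit Types (Xq Xp : 'cV[R]_d * 'cV[R]_d -> 'cV[R]_d).

(* As the domain is finite-dimensional, continuity of z |-> 'd F z in operator
   norm is continuity of z |-> 'd F z h for every h. *)
Definition C1_map (F : 'cV[R]_d * 'cV[R]_d -> 'cV[R]_d) : Prop :=
  (forall z, differentiable F z) /\
  (forall h, continuous (fun z => 'd F z h)).

Definition hamiltonian_of Xq Xp (H : 'cV[R]_d * 'cV[R]_d -> R) : Prop :=
  forall (z : 'cV[R]_d * 'cV[R]_d) (i : 'I_d),
    is_derive z (0, delta_mx i 0) H (Xq z i 0) /\
    is_derive z (delta_mx i 0, 0) H (- Xp z i 0).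

Definition hamiltonian_vector_field Xq Xp : Prop :=
  exists H : 'cV[R]_d * 'cV[R]_d -> R, hamiltonian_of Xq Xp H.

Definition canonicalH Xq Xp (z : 'cV[R]_d * 'cV[R]_d) : R :=
  \int[lebesgue_measure]_(l in `[0, 1])
    (dotp z.2 (Xq (l *: z.1, l *: z.2)) - dotp z.1 (Xp (l *: z.1, l *: z.2))).

End Hamiltonian.

(* Main.v *)
Require Import Defs.
From mathcomp Require Import measurable_realfun lebesgue_integral_under ring lra.

(** X is Hamiltonian iff the 1-form [Xform z h = h_p . X_q z - h_q . X_p z] is
    exact, and by the Poincare lemma iff it is closed, i.e. iff its derivative
    [dXform z k h] is symmetric in (k, h); [canonicalH] is the primitive given
    by the Poincare lemma, and Clairaut's theorem gives the converse.

    On the time scale, Delta-differentiability of rho and nabla-differentiability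
    of sigma force every point to be either isolated or fixed by both jumps, so
    that rho (sigma t) = t and rd-continuity is continuity. Then
    (u . (x o rho))^Delta = u^Delta . x + u . (rho^Delta x^nabla), so the
    derivative parts of <DO h, k> and <DO k, h> differ by a Delta-derivative of
    a function vanishing at both ends. Self-adjointness thus says that the
    Delta-integral of [dXform z k h - dXform z h k] vanishes; testing it at
    constant (q, p) with h and k multiples of (t - a)(b - t) gives symmetry. *)

Set Implicit Arguments.
Unset Strict Implicit.
Unset Printing Implicit Defensive.
Import Order.TTheory GRing.Theory Num.Theory.
Local Open Scope classical_set_scope.
Local Open Scope ring_scope.

(** * Difference quotients along a subset of the reals *)

(** The Delta-integral is defined through antiderivatives, so both directions handle antiderivatives
    rather than integrals. Self-adjointness asserts that two integrals exist, while [rho^Delta] is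
    only known to exist, not to be continuous: adding the Delta-derivative of a boundary term
    removes [rho^Delta] and the nabla-derivative from the integrand, and what remains is continuous,
    hence has an antiderivative. Conversely, a function with nonnegative Delta-derivative is
    nondecreasing on T, hence constant once its two end values agree; this replaces the positivity
    of an integral. The third point of T makes the test function nonzero somewhere: on two points
    [(t - a)(b - t)] vanishes identically. The ends need care. An isolated [b] leaves [kappa_up] and
    an isolated [a] leaves [kappa_dn], yet the Delta-integral still sees [a]. The integrand is 0
    there by convention, which agrees with the boundary term: its factor composed with [rho] is
    evaluated only at [a], where it vanishes. *)

Lemma near_neq {R : realType} (V : normedModType R) (x y : V) :
  x != y -> \forall z \near x, z != y.
Proof.
move=> xy; have : (fun z => z - y) @ x --> x - y by apply: cvgB => //; exact: cvg_cst.
move/cvgr_neq0; rewrite subr_eq0 => /(_ xy).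
by apply: filterS => z; rewrite subr_eq0.
Qed.

Section DifferenceQuotient.
Context {R : realType} (T : set R).

(* With c = sigma t this is the Delta-quotient at t, with c = rho t the
   nabla-quotient: both calculi are instances of one. *)
Definition diffq {V : normedModType R} (c : R) (u : R -> V) (s : R) : V :=
  (c - s)^-1 *: (u c - u s).

Definition qfilter (c t : R) : set_system R :=
  within (T `&` [set s | s != c]) (nbhs t).

Definition isolated_in (t : R) : Prop := \forall s \near t, T s -> s = t.

Lemma within_isolated (V : topologicalType) (D : set R) (f : R -> V) t :
  D `<=` T -> isolated_in t -> f @ within D (nbhs t) --> f t.
Proof.
move=> DT it P /nbhs_singleton Pt; change (\forall s \near t, D s -> P (f s)).
by apply: filterS it => s sT /DT/sT ->.
Qed.

(** [within D (nbhs t)] does not exclude [t] itself, so a limit along it must be the value at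
    [t]. *)
Lemma cvg_within_pt (V : normedModType R) (D : set R) (f : R -> V) t l :
  D t -> f @ within D (nbhs t) --> l -> f t = l.
Proof.
move=> Dt fl; have [//|ftl] := eqVneq (f t) l.
have /fl : nbhs l [set x | x != f t].
  by apply: near_neq; rewrite eq_sym.
by move=> /nbhs_singleton/(_ Dt)/=; rewrite eqxx.
Qed.

Lemma not_isolated_inP t : ~ isolated_in t ->
  forall e, 0 < e -> exists2 s, T s & s != t /\ `|t - s| < e.
Proof.
move=> nit e e0; apply: contrapT => ns; apply: nit.
near=> s => Ts; apply: contrapT => st; apply: ns.
exists s => //; split; first by apply/eqP.
by near: s; exact: cvgr_dist_lt.
Unshelve. all: by end_near. Qed.

(** If [c != t] the point [t] itself lies in every set of the filter; otherwise T has to accumulate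
    at [t]. Properness is what makes quotient limits unique. *)
Lemma qfilter_proper c t : T t -> c != t \/ ~ isolated_in t ->
  ProperFilter (qfilter c t).
Proof.
move=> Tt H; apply: within_nbhs_proper => B tB.
have [ct|ct] := eqVneq c t; last first.
  by exists t; split; [split => //=; rewrite eq_sym|exact: nbhs_singleton].
case: H => [|nit]; first by rewrite ct eqxx.
have /nbhs_ballP[e /= e0 eB] := tB.
have [s Ts [st ts]] := not_isolated_inP nit e0.
by exists s; split; [split => //=; rewrite ct|exact: eB].
Qed.

Context {V : normedModType R}.
Implicit Types (u v : R -> V) (c t : R) (L M : V).

Definition is_qderiv c t u L : Prop := diffq c u @ qfilter c t --> L.

Lemma is_qderiv_unique c t u L M : T t -> c != t \/ ~ isolated_in t ->
  is_qderiv c t u L -> is_qderiv c t u M -> L = M.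
Proof.
move=> Tt H; have PF := qfilter_proper Tt H.
exact: (@cvg_unique _ (@norm_hausdorff R V)).
Qed.

Lemma is_qderiv_isolated c t u : c != t -> isolated_in t ->
  is_qderiv c t u (diffq c u t).
Proof. by move=> ct; apply: within_isolated => s []. Qed.

Lemma diffqK c u s : s != c -> u s = u c - (c - s) *: diffq c u s.
Proof.
move=> sc; rewrite /diffq scalerA divff ?subr_eq0 1?eq_sym// scale1r.
by rewrite opprB addrC subrK.
Qed.

(** By [diffqK], [u] tends to [u c - (c - t) *: L] along the quotient filter. This limit is [u t]:
    trivially when [c = t], and by [cvg_within_pt] when [c != t], as [t] then belongs to the
    filtered set. *)
Lemma is_qderiv_continuous c t u L : T t -> is_qderiv c t u L ->
  u @ within T (nbhs t) --> u t.
Proof.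
move=> Tt uL.
have FF : Filter (qfilter c t) by exact: within_filter.
have id_cvg : (fun s : R => c - s) @ qfilter c t --> c - t.
  apply: cvgB; first exact: cvg_cst.
  exact: cvg_within.
have uq : u @ qfilter c t --> u c - (c - t) *: L.
  have : (fun s => u c - (c - s) *: diffq c u s) @ qfilter c t -->
         u c - (c - t) *: L.
    by apply: cvgB; [exact: cvg_cst|exact: cvgZ].
  apply: cvg_trans; apply: near_eq_cvg.
  by apply: filterS (withinT _ _) => s [_ /= sc]; rewrite -diffqK.
have [ct|ct] := eqVneq c t.
  subst c; rewrite subrr scale0r subr0 in uq.
  move=> P tP; have : \forall s \near t, (T `&` [set s | s != t]) s -> P (u s).
    exact: (uq _ tP).
  apply: filterS => s sP Ts; have [->|st] := eqVneq s t.
    by move/nbhs_singleton : tP.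
  by apply: sP; split.
have /cvg_within_pt utE : (T `&` [set s | s != c]) t by split=> //=; rewrite eq_sym.
rewrite (utE _ _ _ uq) => P tP.
have uP : \forall s \near t, (T `&` [set s | s != c]) s -> P (u s) by exact: (uq _ tP).
have tc : \forall s \near t, s != c.
  by apply: (@near_neq _ R); rewrite eq_sym.
by apply: filterS2 uP tc => s sP sc Ts; apply: sP.
Qed.

Lemma is_qderivD c t u v L M : is_qderiv c t u L -> is_qderiv c t v M ->
  is_qderiv c t (fun s => u s + v s) (L + M).
Proof.
move=> uL vM; rewrite /is_qderiv.
have -> : diffq c (fun s => u s + v s) = (diffq c u \+ diffq c v).
  by apply/funext => s; rewrite /diffq/= -scalerDr opprD addrACA.
by apply: cvgD.
Qed.

Lemma is_qderivZ c t k u L : is_qderiv c t u L ->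
  is_qderiv c t (fun s => k *: u s) (k *: L).
Proof.
move=> uL; rewrite /is_qderiv.
have -> : diffq c (fun s => k *: u s) = (fun s => k *: diffq c u s).
  by apply/funext => s; rewrite /diffq/= -scalerBr !scalerA mulrC.
exact: cvgZr.
Qed.

Lemma is_qderivN c t u L : is_qderiv c t u L ->
  is_qderiv c t (fun s => - u s) (- L).
Proof.
move=> /is_qderivZ -/(_ (-1)); rewrite scaleN1r.
by under [X in is_qderiv _ _ X]eq_fun do rewrite scaleN1r.
Qed.

Lemma is_qderivB c t u v L M : is_qderiv c t u L -> is_qderiv c t v M ->
  is_qderiv c t (fun s => u s - v s) (L - M).
Proof. by move=> uL /is_qderivN; exact: is_qderivD. Qed.

Lemma is_qderiv_cst c t (w : V) : is_qderiv c t (fun=> w) 0.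
Proof.
rewrite /is_qderiv.
have -> : diffq c (fun=> w) = cst 0.
  by apply/funext => s; rewrite /diffq/= subrr scaler0.
exact: cvg_cst.
Qed.

Lemma is_qderiv_eq c t u v L : T c -> {in T, u =1 v} ->
  is_qderiv c t u L -> is_qderiv c t v L.
Proof.
move=> Tc uv; apply: cvg_trans; apply: near_eq_cvg.
apply: filterS (withinT _ _) => s [Ts _].
by rewrite /diffq -!uv ?inE.
Qed.

End DifferenceQuotient.

Lemma is_qderiv_id (R : realType) (T : set R) (c t : R) :
  is_qderiv T c t (fun s => s : R^o) (1 : R).
Proof.
have FF : Filter (qfilter T c t) by exact: within_filter.
have : (fun=> 1 : R) @ qfilter T c t --> (1 : R) by exact: cvg_cst.
apply: cvg_trans; apply: near_eq_cvg.
apply: filterS (withinT _ _) => s [_ /= sc].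
by rewrite /diffq -[RHS]/(_ * _) mulVf// subr_eq0 eq_sym.
Qed.

(** * Jump operators *)

Section Derivatives.
Context {R : realType} (T : set R) {V : normedModType R}.
Implicit Types u : R -> V.

Lemma ndiffE u t : ndiff T u t = diffq (rho T t) u.
Proof.
apply/funext => s; rewrite /ndiff /diffq -[in LHS]opprB invrN scaleNr.
by rewrite -scalerN opprB.
Qed.

Lemma dderivable_qderiv u t : dderivable T u t ->
  is_qderiv T (sigma T t) t u (dderive T u t).
Proof. by []. Qed.

Lemma nderivable_qderiv u t : nderivable T u t ->
  is_qderiv T (rho T t) t u (nderive T u t).
Proof. by rewrite /nderivable /nderive ndiffE. Qed.

End Derivatives.

Section BoundedTimeScale.
Context {R : realType} (T : set R).
Hypothesis hT : bounded_time_scale T.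

Local Notation a := (tmin T).
Local Notation b := (tmax T).
Local Notation sigma := (sigma T).
Local Notation rho := (rho T).

Lemma timescale_closed : closed T.
Proof. by case: hT => _; apply: compact_closed; exact: norm_hausdorff. Qed.

Lemma timescale_min : T a /\ forall t, T t -> a <= t.
Proof.
case: hT => T0 cT.
have [c /set_mem Tc cm] := @compact_EVT_min _ _ id _ T0 cT (continuous_subspaceT (fun x => cvg_id)).
suff -> : a = c by split => // t Tt; apply: cm; rewrite inE.
apply/le_anti/andP; split.
  by apply: ge_inf => //; exists c => t Tt; apply: cm; rewrite inE.
by apply: lb_le_inf => // t Tt; apply: cm; rewrite inE.
Qed.

Lemma timescale_max : T b /\ forall t, T t -> t <= b.
Proof.
case: hT => T0 cT.
have [c /set_mem Tc cm] := @compact_EVT_max _ _ id _ T0 cT (continuous_subspaceT (fun x => cvg_id)).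
suff -> : b = c by split => // t Tt; apply: cm; rewrite inE.
apply/le_anti/andP; split.
  by apply: ge_sup => // t Tt; apply: cm; rewrite inE.
by apply: ub_le_sup => //; exists c => t Tt; apply: cm; rewrite inE.
Qed.

Lemma tmin_in : T a. Proof. exact: timescale_min.1. Qed.
Lemma tmax_in : T b. Proof. exact: timescale_max.1. Qed.
Lemma tmin_le t : T t -> a <= t. Proof. exact: timescale_min.2. Qed.
Lemma le_tmax t : T t -> t <= b. Proof. exact: timescale_max.2. Qed.

Lemma inf_in (S : set R) : S !=set0 -> S `<=` T -> T (inf S).
Proof.
move=> S0 ST.
have hS : has_inf S by split => //; exists a => s /ST; exact: tmin_le.
apply: timescale_closed => B /nbhs_ballP[e /= e0 eB].
have [s Ss se] := inf_adherent e0 hS.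
exists s; split; first exact: ST.
apply: eB; rewrite /ball/= ltr_distlC; have := ge_inf hS.2 Ss; lra.
Qed.

Lemma sup_in (S : set R) : S !=set0 -> S `<=` T -> T (sup S).
Proof.
move=> S0 ST.
have hS : has_sup S by split => //; exists b => s /ST; exact: le_tmax.
apply: timescale_closed => B /nbhs_ballP[e /= e0 eB].
have [s Ss se] := sup_adherent e0 hS.
exists s; split; first exact: ST.
apply: eB; rewrite /ball/= ltr_distlC; have := ub_le_sup hS.2 Ss; lra.
Qed.

Lemma sigma_spec t : T t -> t < b ->
  [/\ T (sigma t), t <= sigma t & forall s, T s -> t < s -> sigma t <= s].
Proof.
move=> Tt tb; rewrite /sigma.
have S0 : T `&` [set s | t < s] !=set0 by exists b; split => //; exact: tmax_in.
have lS : has_lbound (T `&` [set s | t < s]) by exists t => s [_ /=] /ltW.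
rewrite ifF; last by apply/negbTE/set0P.
split; first by apply: inf_in => // s [].
  by apply: lb_le_inf => // s [_ /=] /ltW.
by move=> s Ts ts; apply: ge_inf.
Qed.

Lemma rho_spec t : T t -> a < t ->
  [/\ T (rho t), rho t <= t & forall s, T s -> s < t -> s <= rho t].
Proof.
move=> Tt tb; rewrite /rho.
have S0 : T `&` [set s | s < t] !=set0 by exists a; split => //; exact: tmin_in.
have lS : has_ubound (T `&` [set s | s < t]) by exists t => s [_ /=] /ltW.
rewrite ifF; last by apply/negbTE/set0P.
split; first by apply: sup_in => // s [].
  by apply: ge_sup => // s [_ /=] /ltW.
by move=> s Ts ts; apply: ub_le_sup.
Qed.

Lemma sigma_tmax : sigma b = b.
Proof.
rewrite /sigma ifT //; apply/eqP; rewrite -subset0 => s [/le_tmax sb /= bs].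
lra.
Qed.

Lemma rho_tmin : rho a = a.
Proof.
rewrite /rho ifT //; apply/eqP; rewrite -subset0 => s [/tmin_le sb /= bs].
lra.
Qed.

Lemma sigma_in t : T t -> T (sigma t).
Proof.
move=> Tt; have := le_tmax Tt; rewrite le_eqVlt => /orP[/eqP->|tb].
  by rewrite sigma_tmax; exact: tmax_in.
by case: (sigma_spec Tt tb).
Qed.

Lemma rho_in t : T t -> T (rho t).
Proof.
move=> Tt; have := tmin_le Tt; rewrite le_eqVlt => /orP[/eqP<-|tb].
  by rewrite rho_tmin; exact: tmin_in.
by case: (rho_spec Tt tb).
Qed.

Lemma rho_eq t m : T t -> T m -> m < t ->
  (forall s, T s -> s < t -> s <= m) -> rho t = m.
Proof.
move=> Tt Tm tm mmin; have tb := le_lt_trans (tmin_le Tm) tm.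
have [_ _ sm] := rho_spec Tt tb; apply/le_anti; rewrite sm//= andbT /rho.
rewrite ifF; last by apply/negbTE/set0P; exists m.
by apply: ge_sup; [exists m|move=> s [/= Ts ts]; exact: mmin].
Qed.

Lemma sigma_id_adherent t e : T t -> t < b -> sigma t = t -> 0 < e ->
  exists2 s, T s & t < s < t + e.
Proof.
move=> Tt tb; rewrite /sigma.
have S0 : T `&` [set s | t < s] !=set0 by exists b; split => //; exact: tmax_in.
rewrite ifF; last by apply/negbTE/set0P.
move=> st e0; have [|s [Ts ts] se] := @inf_adherent _ (T `&` [set s | t < s]) _ e0.
  by split => //; exists t => s [_ /=] /ltW.
by exists s => //; rewrite ts/=; rewrite st in se.
Qed.

Lemma rho_id_adherent t e : T t -> a < t -> rho t = t -> 0 < e ->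
  exists2 s, T s & t - e < s < t.
Proof.
move=> Tt tb; rewrite /rho.
have S0 : T `&` [set s | s < t] !=set0 by exists a; split => //; exact: tmin_in.
rewrite ifF; last by apply/negbTE/set0P.
move=> st e0; have [|s [Ts ts] se] := @sup_adherent _ (T `&` [set s | s < t]) _ e0.
  by split => //; exists t => s [_ /=] /ltW.
by exists s => //; rewrite ts/= andbT; rewrite st in se.
Qed.

Lemma sigma_id_not_isolated t : T t -> t < b -> sigma t = t -> ~ isolated_in T t.
Proof.
move=> Tt tb st /nbhs_ballP[e /= e0 eB].
have [s Ts /andP[ts se]] := sigma_id_adherent Tt tb st e0.
have : s = t by apply: (eB s) => //; rewrite /ball/= ltr_distlC; lra.
lra.
Qed.

Lemma rho_id_not_isolated t : T t -> a < t -> rho t = t -> ~ isolated_in T t.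
Proof.
move=> Tt tb st /nbhs_ballP[e /= e0 eB].
have [s Ts /andP[ts se]] := rho_id_adherent Tt tb st e0.
have : s = t by apply: (eB s) => //; rewrite /ball/= ltr_distlC; lra.
lra.
Qed.

Lemma isolated_lt_sigma t : T t -> t < b -> isolated_in T t -> t < sigma t.
Proof.
move=> Tt tb it; have [_ ts _] := sigma_spec Tt tb; rewrite lt_neqAle ts andbT.
by apply/negP => /eqP/esym/(sigma_id_not_isolated Tt tb).
Qed.

Lemma isolated_rho_lt t : T t -> a < t -> isolated_in T t -> rho t < t.
Proof.
move=> Tt tb it; have [_ ts _] := rho_spec Tt tb; rewrite lt_neqAle ts andbT.
by apply/negP => /eqP/(rho_id_not_isolated Tt tb).
Qed.

Lemma rho_sigma t : T t -> t < b -> t < sigma t -> rho (sigma t) = t.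
Proof.
move=> Tt tb ts; have [Ts _ smin] := sigma_spec Tt tb.
apply: rho_eq => // s Ts' sst; rewrite leNgt; apply/negP => /(smin _ Ts').
by rewrite leNgt sst.
Qed.

Hypothesis hab : a < b.

Lemma kappa_up_lt t : T t -> t < b -> kappa_up T t.
Proof.
move=> Tt tb; split => //=; rewrite in_itv/= => /andP[rt _].
have [_ _ /(_ _ Tt tb)] := rho_spec tmax_in hab; lra.
Qed.

Lemma kappa_dn_lt t : T t -> a < t -> kappa_dn T t.
Proof.
move=> Tt tb; split => //=; rewrite in_itv/= => /andP[_ rt].
have [_ _ /(_ _ Tt tb)] := sigma_spec tmin_in hab; lra.
Qed.

(** * Structure of T forced by differentiable jump operators *)

Hypothesis hrho : forall t, kappa_up T t -> dderivable T rho t.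
Hypothesis hsigma : forall t, kappa_dn T t -> nderivable T sigma t.

(** If [t < sigma t], nothing of T lies just to the right of [t], so T accumulates at [t] from the
    left. Nabla-differentiability makes [sigma] continuous at [t], hence [sigma s > t] for [s] close
    to [t]; but [sigma s <= t] for every [s < t] in T. *)
Lemma not_isolated_sigma t : T t -> ~ isolated_in T t -> sigma t = t.
Proof.
move=> Tt nit; have := le_tmax Tt; rewrite le_eqVlt => /orP[/eqP->|tb].
  exact: sigma_tmax.
have [Ts ts smin] := sigma_spec Tt tb.
move: ts; rewrite le_eqVlt => /orP[/eqP//|ts].
have ladh e : 0 < e -> exists2 s, T s & t - e < s < t.
  move=> e0; have m0 : 0 < Num.min e (sigma t - t) by rewrite lt_min e0 subr_gt0.
  have [s Ts' [st]] := not_isolated_inP nit m0; rewrite lt_min !ltr_distlC.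
  move=> /andP[/andP[h1 h2] /andP[h3 h4]]; exists s => //; rewrite h1/= ltNge.
  rewrite le_eqVlt eq_sym (negbTE st)/=; apply/negP => /(smin _ Ts'); lra.
have at_ : a < t by have [s /tmin_le] := ladh _ ltr01; lra.
have := is_qderiv_continuous Tt (nderivable_qderiv (hsigma (kappa_dn_lt Tt at_))).
move=> /(_ [set y | t < y]); case.
  by exists (sigma t - t) => /=; [lra|move=> y /=; rewrite ltr_distlC; lra].
move=> e /= e0 eB; have [s Ts' /andP[s1 s2]] := ladh _ e0.
have : t < sigma s by apply: (eB s) => //=; rewrite ltr_distlC; lra.
have sb := lt_trans s2 tb.
by have [_ _ /(_ _ Tt s2)] := sigma_spec Ts' sb; lra.
Qed.

Lemma not_isolated_rho t : T t -> ~ isolated_in T t -> rho t = t.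
Proof.
move=> Tt nit; have := tmin_le Tt; rewrite le_eqVlt => /orP[/eqP<-|tb].
  exact: rho_tmin.
have [Ts ts smin] := rho_spec Tt tb.
move: ts; rewrite le_eqVlt => /orP[/eqP//|ts].
have ladh e : 0 < e -> exists2 s, T s & t < s < t + e.
  move=> e0; have m0 : 0 < Num.min e (t - rho t) by rewrite lt_min e0 subr_gt0.
  have [s Ts' [st]] := not_isolated_inP nit m0; rewrite lt_min !ltr_distlC.
  move=> /andP[/andP[h1 h2] /andP[h3 h4]]; exists s => //; rewrite h2 andbT ltNge.
  rewrite le_eqVlt (negbTE st)/=; apply/negP => /(smin _ Ts'); lra.
have at_ : t < b by have [s /le_tmax] := ladh _ ltr01; lra.
have := is_qderiv_continuous Tt (dderivable_qderiv (hrho (kappa_up_lt Tt at_))).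
move=> /(_ [set y | y < t]); case.
  by exists (t - rho t) => /=; [lra|move=> y /=; rewrite ltr_distlC; lra].
move=> e /= e0 eB; have [s Ts' /andP[s1 s2]] := ladh _ e0.
have : rho s < t by apply: (eB s) => //=; rewrite ltr_distlC; lra.
have sb := lt_trans tb s1.
by have [_ _ /(_ _ Tt s1)] := rho_spec Ts' sb; lra.
Qed.

(** No point of T lies strictly between [rho b] and [b], so only [b] can be removed, and it is
    removed when [rho b < b]. Since accumulation at [b] forces [rho b = b] and conversely, this
    happens exactly when [b] is isolated. *)
Lemma kappa_upP t : kappa_up T t <-> T t /\ (t < b \/ ~ isolated_in T t).
Proof.
split=> [[Tt tb]|[Tt [tb|nit]]]; last 2 first.
- exact: kappa_up_lt.
- split => //=; rewrite in_itv/= => /andP[rt tb].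
  have := le_tmax Tt; rewrite le_eqVlt => /orP[/eqP tE|tb'].
    by have := not_isolated_rho Tt nit; rewrite -{}tE in rt tb *; lra.
  by have [_] := kappa_up_lt Tt tb'; apply; rewrite /= in_itv/= rt.
split => //; have := le_tmax Tt; rewrite le_eqVlt => /orP[/eqP tE|]; last by left.
right; apply: rho_id_not_isolated => //; first by rewrite tE.
have [_ rb _] := rho_spec tmax_in hab.
apply/eqP; rewrite tE eq_le rb/= leNgt; apply/negP => rbb.
by apply: tb; rewrite /= in_itv/= tE rbb lexx.
Qed.

Lemma kappa_dnP t : kappa_dn T t <-> T t /\ (a < t \/ ~ isolated_in T t).
Proof.
split=> [[Tt tb]|[Tt [tb|nit]]]; last 2 first.
- exact: kappa_dn_lt.
- split => //=; rewrite in_itv/= => /andP[tb rt].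
  have := tmin_le Tt; rewrite le_eqVlt => /orP[/eqP tE|tb'].
    by have := not_isolated_sigma Tt nit; rewrite -{}tE in rt tb *; lra.
  by have [_] := kappa_dn_lt Tt tb'; apply; rewrite /= in_itv/= rt tb.
split => //; have := tmin_le Tt; rewrite le_eqVlt => /orP[/eqP tE|]; last by left.
right; apply: sigma_id_not_isolated => //; first by rewrite -tE.
have [_ rb _] := sigma_spec tmin_in hab.
apply/eqP; rewrite -tE eq_le rb andbT leNgt; apply/negP => rbb.
by apply: tb; rewrite /= in_itv/= -tE rbb lexx.
Qed.

(** The hypotheses of [qfilter_proper] for the Delta-quotient: on [kappa_up] the [lim] in [dderive]
    is determined by any limit found by hand. *)
Lemma kappa_up_proper t : kappa_up T t ->
  T t /\ (sigma t != t \/ ~ isolated_in T t).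
Proof.
move=> /kappa_upP[Tt [tb|]]; last by split=> //; right.
split => //; have [it|] := pselect (isolated_in T t); last by right.
by left; rewrite gt_eqF// isolated_lt_sigma.
Qed.

Lemma kappa_dn_proper t : kappa_dn T t ->
  T t /\ (rho t != t \/ ~ isolated_in T t).
Proof.
move=> /kappa_dnP[Tt [tb|]]; last by split=> //; right.
split => //; have [it|] := pselect (isolated_in T t); last by right.
by left; rewrite lt_eqF// isolated_rho_lt.
Qed.

End BoundedTimeScale.

(** * Integration by parts on a time scale *)

Section Dotp.
Context {R : realType} {n : nat}.
Implicit Types x y z : 'cV[R]_n.

Lemma dotpE x y : dotp x y = \sum_i x i 0 * y i 0.
Proof. by rewrite /dotp mxE; apply: eq_bigr => i _; rewrite mxE. Qed.

Lemma dotpC x y : dotp x y = dotp y x.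
Proof. by rewrite !dotpE; apply: eq_bigr => i _; rewrite mulrC. Qed.

Lemma dotpDl x y z : dotp (x + y) z = dotp x z + dotp y z.
Proof. by rewrite /dotp linearD mulmxDl mxE. Qed.

Lemma dotpDr x y z : dotp z (x + y) = dotp z x + dotp z y.
Proof. by rewrite /dotp mulmxDr mxE. Qed.

Lemma dotpNl x z : dotp (- x) z = - dotp x z.
Proof. by rewrite /dotp linearN mulNmx mxE. Qed.

Lemma dotpNr x z : dotp z (- x) = - dotp z x.
Proof. by rewrite /dotp mulmxN mxE. Qed.

Lemma dotpBl x y z : dotp (x - y) z = dotp x z - dotp y z.
Proof. by rewrite dotpDl dotpNl. Qed.

Lemma dotpBr x y z : dotp z (x - y) = dotp z x - dotp z y.
Proof. by rewrite dotpDr dotpNr. Qed.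

Lemma dotpZl k x z : dotp (k *: x) z = k * dotp x z.
Proof. by rewrite /dotp linearZ -scalemxAl mxE. Qed.

Lemma dotpZr k x z : dotp z (k *: x) = k * dotp z x.
Proof. by rewrite /dotp -scalemxAr mxE. Qed.

Lemma dotp0l z : dotp 0 z = 0 :> R.
Proof. by rewrite -(scale0r 0) dotpZl mul0r. Qed.

Lemma dotp0r z : dotp z 0 = 0 :> R.
Proof. by rewrite dotpC dotp0l. Qed.

Lemma dotp_deltal i x : dotp (delta_mx i 0) x = x i 0.
Proof.
rewrite dotpE (bigD1 i)//= mxE !eqxx mul1r big1 ?addr0// => j ji.
by rewrite mxE (negbTE ji) mul0r.
Qed.

Lemma cvg_coord {S} (F : set_system S) {FF : Filter F} (f : S -> 'cV[R]_n)
    (l : 'cV[R]_n) i :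
  f @ F --> l -> (fun s => f s i 0) @ F --> l i 0.
Proof.
move=> fl; exact: (cvg_comp f (fun M : 'cV[R]_n => M i 0) fl
  (@coord_continuous R n 1 i 0 l)).
Qed.

Lemma cvg_dotp {S} (F : set_system S) {FF : Filter F} (f g : S -> 'cV[R]_n)
    (l m : 'cV[R]_n) :
  f @ F --> l -> g @ F --> m -> (fun s => dotp (f s) (g s)) @ F --> dotp l m.
Proof.
move=> fl gm; rewrite dotpE.
under eq_fun do rewrite dotpE.
apply: cvg_big => [z|i _]; first by apply: cvgD; [exact: cvg_fst|exact: cvg_snd].
by apply: cvgM; exact: cvg_coord.
Qed.

End Dotp.

Lemma dotp_col_mx (R : realType) n (x1 x2 y1 y2 : 'cV[R]_n) :
  dotp (col_mx x1 x2) (symplJ R n *m col_mx y1 y2) = dotp x1 y2 - dotp x2 y1.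
Proof.
rewrite /symplJ /dotp mul_block_col tr_col_mx mul_row_col.
by rewrite !mul0mx !mulNmx !mul1mx addr0 add0r mulmxN !mxE.
Qed.

(** The product rule is an exact identity between quotients, with [x] taken at the jump point [c]
    and [u] at the running point [s]; continuity of [u] at [t] then gives the limit. *)
Lemma is_qderiv_dotp {R : realType} {n : nat} (T : set R) c t
    (u x : R -> 'cV[R]_n) L M : T t ->
  is_qderiv T c t u L -> is_qderiv T c t x M ->
  is_qderiv T c t (fun s => dotp (u s) (x s)) (dotp L (x c) + dotp (u t) M).
Proof.
move=> Tt uL xM.
have FF : Filter (qfilter T c t) by exact: within_filter.
have ut : u @ qfilter T c t --> u t.
  apply: cvg_trans (is_qderiv_continuous Tt uL).
  by apply: cvg_app; apply: within_subset => s [].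
rewrite /is_qderiv.
have -> : diffq c (fun s => dotp (u s) (x s)) =
    (fun s => dotp (diffq c u s) (x c) + dotp (u s) (diffq c x s)).
  apply/funext => s; rewrite /diffq dotpZl dotpZr dotpBl dotpBr -mulrDr.
  by rewrite [in RHS]addrA addrNK.
by apply: cvgD; apply: cvg_dotp => //; exact: cvg_cst.
Qed.

Section TimeScaleCalculus.
Context {R : realType} (T : set R).
Hypothesis hT : bounded_time_scale T.

Local Notation a := (tmin T).
Local Notation b := (tmax T).
Local Notation sigma := (sigma T).
Local Notation rho := (rho T).

Hypothesis hab : a < b.
Hypothesis hrho : forall t, kappa_up T t -> dderivable T rho t.
Hypothesis hsigma : forall t, kappa_dn T t -> nderivable T sigma t.

Let kupP := kappa_upP hT hab hrho.
Let kdnP := kappa_dnP hT hab hsigma.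

Lemma kappa_up_cases t : T t -> kappa_up T t \/ (t = b /\ isolated_in T t).
Proof.
move=> Tt; have := le_tmax hT Tt; rewrite le_eqVlt => /orP[/eqP tE|tb].
  have [it|nit] := pselect (isolated_in T t); first by right.
  by left; apply/kupP; split => //; right.
by left; apply/kupP; split => //; left.
Qed.

Lemma kappa_dn_cases t : T t -> kappa_dn T t \/ (t = a /\ isolated_in T t).
Proof.
move=> Tt; have := tmin_le hT Tt; rewrite le_eqVlt => /orP[/eqP tE|tb].
  have [it|nit] := pselect (isolated_in T t); first by right.
  by left; apply/kdnP; split => //; right.
by left; apply/kdnP; split => //; left.
Qed.

Section Normed.
Context {V : normedModType R}.
Implicit Types (u v : R -> V).

Lemma dderive_eq u t L : kappa_up T t -> is_qderiv T (sigma t) t u L ->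
  dderivable T u t /\ dderive T u t = L.
Proof.
move=> kt uL; have [Tt PF] := kappa_up_proper hT hab hrho kt.
have := qfilter_proper Tt PF => FF.
have cu : dderivable T u t by apply/cvg_ex; exists L.
split => //; apply: is_qderiv_unique PF _ uL => //.
Qed.

Lemma nderive_eq u t L : kappa_dn T t -> is_qderiv T (rho t) t u L ->
  nderivable T u t /\ nderive T u t = L.
Proof.
move=> kt uL; have [Tt PF] := kappa_dn_proper hT hab hsigma kt.
have := qfilter_proper Tt PF => FF.
have cu : nderivable T u t by apply/cvg_ex; exists L; rewrite ndiffE.
split => //; apply: is_qderiv_unique PF (nderivable_qderiv cu) uL => //.
Qed.

Lemma dderivable_continuous u : (forall t, kappa_up T t -> dderivable T u t) ->
  forall t, T t -> u @ within T (nbhs t) --> u t.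
Proof.
move=> du t Tt; have [kt|[_ it]] := kappa_up_cases Tt.
  exact: is_qderiv_continuous Tt (dderivable_qderiv (du _ kt)).
exact: within_isolated it.
Qed.

Lemma nderivable_continuous u : (forall t, kappa_dn T t -> nderivable T u t) ->
  forall t, T t -> u @ within T (nbhs t) --> u t.
Proof.
move=> du t Tt; have [kt|[_ it]] := kappa_dn_cases Tt.
  exact: is_qderiv_continuous Tt (nderivable_qderiv (du _ kt)).
exact: within_isolated it.
Qed.

Lemma rd_continuousP u : rd_continuous_on T (kappa_up T) u <->
  forall t, kappa_up T t -> u @ within (kappa_up T) (nbhs t) --> u t.
Proof.
split=> [[ud _] t kt|uc].
  have [it|nit] := pselect (isolated_in T t).
    by apply: within_isolated it => s [].
  by apply: ud => //; apply: (not_isolated_sigma hT hab hsigma) => //; case: kt.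
split=> [t kt _|t kt _]; first exact: uc.
apply/cvg_ex; exists (u t); apply: cvg_trans (uc _ kt).
by apply: cvg_app; apply: within_subset => s [].
Qed.

Lemma ld_continuousP u : ld_continuous_on T (kappa_dn T) u <->
  forall t, kappa_dn T t -> u @ within (kappa_dn T) (nbhs t) --> u t.
Proof.
split=> [[ud _] t kt|uc].
  have [it|nit] := pselect (isolated_in T t).
    by apply: within_isolated it => s [].
  by apply: ud => //; apply: (not_isolated_rho hT hab hrho) => //; case: kt.
split=> [t kt _|t kt _]; first exact: uc.
apply/cvg_ex; exists (u t); apply: cvg_trans (uc _ kt).
by apply: cvg_app; apply: within_subset => s [].
Qed.

(** A chain rule. At an isolated point both derivatives are plain quotients, and since
    [rho (sigma t) = t] the increment [t - rho t] of [rho] cancels the denominator of the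
    nabla-quotient. At any other point both jumps fix [t] and the classical argument applies. *)
Lemma is_qderiv_rho u t : kappa_up T t -> kappa_dn T t -> nderivable T u t ->
  is_qderiv T (sigma t) t (fun s => u (rho s)) (dderive T rho t *: nderive T u t).
Proof.
move=> kut kdt /nderivable_qderiv un.
have [Tt _] := kut.
have rq := dderivable_qderiv (hrho kut).
have [it|nit] := pselect (isolated_in T t).
  have tb : t < b by have [_ []] := (kupP t).1 kut.
  have at_ : a < t by have [_ []] := (kdnP t).1 kdt.
  have ts := isolated_lt_sigma hT Tt tb it.
  have rt := isolated_rho_lt hT Tt at_ it.
  have -> : dderive T rho t = diffq (sigma t) rho t.
    apply: is_qderiv_unique Tt _ rq _; first by left; rewrite gt_eqF.
    by apply: is_qderiv_isolated => //; rewrite gt_eqF.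
  have -> : nderive T u t = diffq (rho t) u t.
    apply: is_qderiv_unique Tt _ un _; first by left; rewrite lt_eqF.
    by apply: is_qderiv_isolated => //; rewrite lt_eqF.
  have -> : diffq (sigma t) rho t *: diffq (rho t) u t =
            diffq (sigma t) (fun s => u (rho s)) t.
    rewrite /diffq (rho_sigma hT Tt tb ts) scalerA -[_ *: (t - rho t)]/(_ * _).
    rewrite -mulrA -[rho t - t]opprB invrN mulrN divff ?subr_eq0 ?gt_eqF//.
    by rewrite mulrN1 scaleNr -scalerN opprB.
  by apply: is_qderiv_isolated => //; rewrite gt_eqF.
have st := not_isolated_sigma hT hab hsigma Tt nit.
have rt := not_isolated_rho hT hab hrho Tt nit.
rewrite rt st in un rq *.
have FF : Filter (qfilter T t t) by exact: within_filter.
(* Caratheodory's slope: filling the quotient at [t] with the derivative keeps the factorization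
   valid at points [s] with [rho s = t]. *)
pose q s := if s == t then nderive T u t else diffq t u s.
have qt : q @ within T (nbhs t) --> nderive T u t.
  move=> P /[dup] /un uP /nbhs_singleton Pt.
  have {}uP : \forall s \near t, (T `&` [set s | s != t]) s -> P (diffq t u s).
    exact: uP.
  apply: filterS uP => s sP Ts; rewrite /= /q; case: eqVneq => // nst.
  exact: sP.
have rc : rho @ qfilter T t t --> within T (nbhs t).
  move=> P; rewrite /within /= => tP.
  have := is_qderiv_continuous Tt rq; rewrite rt => /(_ _ tP) rP.
  have {}rP : \forall s \near t, T s -> T (rho s) -> P (rho s) by exact: rP.
  by apply: filterS rP => s sP [Ts _]; apply: sP => //; exact: rho_in.
rewrite /is_qderiv.
have -> : diffq t (fun s => u (rho s)) = (fun s => diffq t rho s *: q (rho s)).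
  apply/funext => s; rewrite /q /diffq; case: eqVneq => [->|rst].
    by rewrite !rt !subrr !scaler0 scale0r.
  rewrite !rt scalerA -[_ *: (t - rho s)]/(_ * _) -mulrA divff ?mulr1//.
  by rewrite subr_eq0 eq_sym.
apply: cvgZ => //.
exact: (cvg_comp rho q rc qt).
Qed.

End Normed.

(* The product rule evaluates x o rho at sigma t, and rho (sigma t) = t; at an
   isolated minimum, outside kappa_dn, the derivative is 0 because x vanishes. *)
Lemma is_qderiv_dotp_rho n (u x : R -> 'cV[R]_n) t :
  (forall t, kappa_up T t -> dderivable T u t) ->
  (forall t, kappa_dn T t -> nderivable T x t) -> x a = 0 -> kappa_up T t ->
  is_qderiv T (sigma t) t (fun s => dotp (u s) (x (rho s)))
    (if t \in kappa_dn T then dotp (dderive T u t) (x t) +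
       dotp (u t) (dderive T rho t *: nderive T x t) else 0).
Proof.
move=> du dx xa kt; have [Tt _] := kt.
case: ifPn => [/set_mem kdt|].
  have rs : rho (sigma t) = t.
    have [_ [tb|nit]] := (kupP t).1 kt.
      have [it|nit] := pselect (isolated_in T t).
        by apply: rho_sigma => //; exact: isolated_lt_sigma.
      by rewrite (not_isolated_sigma hT hab hsigma Tt nit)
        (not_isolated_rho hT hab hrho Tt nit).
    by rewrite (not_isolated_sigma hT hab hsigma Tt nit)
      (not_isolated_rho hT hab hrho Tt nit).
  have := is_qderiv_dotp Tt (dderivable_qderiv (du _ kt))
    (is_qderiv_rho kt kdt (dx _ kdt)).
  by rewrite /= rs.
rewrite notin_setE => nkdt.
have [//|[ta it]] := kappa_dn_cases Tt.
have tb : t < b by rewrite ta.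
have ts := isolated_lt_sigma hT Tt tb it.
have : is_qderiv T (sigma t) t (fun s => dotp (u s) (x (rho s)))
    (diffq (sigma t) (fun s => dotp (u s) (x (rho s))) t).
  by apply: is_qderiv_isolated => //; rewrite gt_eqF.
by rewrite /diffq (rho_sigma hT Tt tb ts) ta rho_tmin// xa !dotp0r subrr scaler0.
Qed.

End TimeScaleCalculus.

(** * Delta-antiderivatives *)

Lemma is_qderiv_derive1 (R : realType) (T : set R) (F : R -> R) (t : R) :
  derivable F t 1 -> is_qderiv T t t F (F^`()%classic t).
Proof.
move=> dF.
have FF : Filter (qfilter T t t) by exact: within_filter.
have Fq : (fun h : R => h^-1 *: (F (h + t) - F t)) @ (0 : R)^' -->
    F^`()%classic t.
  rewrite derive1E; move: dF; rewrite /derivable /derive.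
  by under eq_fun do rewrite scaler1.
have st : (fun s => s - t) @ qfilter T t t --> (0 : R)^'.
  move=> P [e /= e0 eP]; exists e => //= s /= ts [_ /= st].
  by apply: eP; rewrite /= ?subr_eq0// sub0r opprB.
have := cvg_comp _ _ st Fq; apply: cvg_trans; apply: near_eq_cvg.
apply: filterS (withinT _ _) => s [_ /= st'].
by rewrite addrNK /diffq -[in RHS]opprB invrN scaleNr -scalerN opprB.
Qed.

Section Integration.
Context {R : realType} (T : set R).
Hypothesis hT : bounded_time_scale T.

Local Notation a := (tmin T).
Local Notation b := (tmax T).
Local Notation sigma := (sigma T).
Local Notation rho := (rho T).

Hypothesis hab : a < b.
Hypothesis hrho : forall t, kappa_up T t -> dderivable T rho t.
Hypothesis hsigma : forall t, kappa_dn T t -> nderivable T sigma t.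

(* After adding e * t the derivative is positive, so a maximum over T between r
   and s can only be attained at s. *)
Lemma qderiv_ge0_nondecreasing (F f : R -> R) :
  (forall t, kappa_up T t -> is_qderiv T (sigma t) t F (f t) /\ 0 <= f t) ->
  forall r s, T r -> T s -> r <= s -> F r <= F s.
Proof.
move=> dF r s Tr Ts; rewrite le_eqVlt => /orP[/eqP->//|rs].
rewrite leNgt; apply/negP => Fsr.
(* Half the mean rate of descent of [F] from [r] to [s], so that adding [e * x] still leaves
   [G s < G r]. *)
pose e := (F r - F s) / (2 * (s - r)).
have e0 : 0 < e by rewrite divr_gt0 ?mulr_gt0 ?subr_gt0.
pose G x := F x + e * x.
have Gsr : G s < G r.
  have : e * (s - r) = (F r - F s) / 2 by rewrite /e; field; lra.
  by rewrite /G; lra.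
have dG t : kappa_up T t -> is_qderiv T (sigma t) t G (f t + e).
  move=> kt; have := is_qderivD (dF _ kt).1
    (@is_qderivZ _ T _ _ _ e _ _ (is_qderiv_id T (sigma t) t)).
  by rewrite -[e *: _]/(e * 1) mulr1.
have Gc : forall t, T t -> G @ within T (nbhs t) --> G t.
  apply: (dderivable_continuous hT hab hrho) => t' kt'.
  exact: (dderive_eq hT hab hrho kt' (dG _ kt')).1.
pose A := T `&` `[r, s].
have cA : compact A.
  apply: compact_closedI; first by case: hT.
  exact: interval_closed.
have [||c /set_mem[Tc crs] cmax] := @compact_EVT_max _ _ G A _ cA.
- by exists r; split => //=; rewrite in_itv/= lexx ltW.
- apply/subspace_continuousP => t [Tt _]; apply: cvg_trans (Gc _ Tt).
  by apply: cvg_app; apply: within_subset => ? [].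
move: crs; rewrite /= in_itv/= => /andP[rc]; rewrite le_eqVlt => /orP[/eqP cs|cs].
  move: Gsr; rewrite -cs ltNge => /negP; apply; apply: cmax; rewrite inE.
  by split => //=; rewrite in_itv/= lexx ltW.
have cb : c < b by exact: lt_le_trans cs (le_tmax hT Ts).
have kc := kappa_up_lt hT hab Tc cb.
have m0 : 0 < f c + e by have := (dF _ kc).2; lra.
have {}cmax y : T y -> c <= y <= s -> G y <= G c.
  move=> Ty ys; apply: cmax; rewrite inE; split => //=; rewrite in_itv/=; lra.
(* A positive derivative at [c] yields a larger value of [G] to the right of [c] and not beyond [s]:
   at [sigma c <= s] if [c] is isolated, at a nearby point of T otherwise. *)
have [it|nit] := pselect (isolated_in T c).
  have cs' := isolated_lt_sigma hT Tc cb it.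
  have [Ts' _ smin] := sigma_spec hT Tc cb.
  have E : f c + e = diffq (sigma c) G c.
    apply: is_qderiv_unique Tc _ (dG _ kc) _; first by left; rewrite gt_eqF.
    by apply: is_qderiv_isolated => //; rewrite gt_eqF.
  have : 0 < (sigma c - c) * diffq (sigma c) G c by rewrite -E mulr_gt0 ?subr_gt0.
  rewrite /diffq mulrA divff ?mul1r ?subr_eq0 ?gt_eqF// subr_gt0 ltNge => /negP.
  by apply; apply: cmax => //; rewrite ltW//= smin.
have sc := not_isolated_sigma hT hab hsigma Tc nit.
have := dG _ kc; rewrite sc => /(_ [set y | 0 < y]).
case; first by exists (f c + e) => //= y /=; rewrite ltr_distlC; lra.
move=> d /= d0 dP.
have m1 : 0 < Num.min d (s - c) by rewrite lt_min d0 subr_gt0.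
have [y Ty] := sigma_id_adherent hT Tc cb sc m1.
rewrite -ltrBlDl lt_min => /and3P[cy yd ys].
have : 0 < diffq c G y.
  apply: (dP y); first by rewrite /= ltr_distlC; lra.
  by split => //=; rewrite gt_eqF.
have Gyc : G y <= G c by apply: cmax => //; lra.
rewrite /diffq -[_ *: _]/(_ * _) nmulr_rgt0 ?invr_lt0 ?subr_lt0//.
by rewrite ltNge Gyc.
Qed.

(** The branch below [a] keeps all values in T: the integral in [dantiderivative] starts at [a - 1],
    so that [a] is interior to the domain of integration. *)
Definition tfloor (x : R) : R :=
  if x < a then a else sup (T `&` [set s | s <= x]).

Lemma tfloor_spec x : a <= x ->
  [/\ T (tfloor x), tfloor x <= x & forall s, T s -> s <= x -> s <= tfloor x].
Proof.
move=> ax; rewrite /tfloor ltNge ax /=.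
have S0 : T `&` [set s | s <= x] !=set0 by exists a; split => //; exact: tmin_in.
have lS : has_ubound (T `&` [set s | s <= x]) by exists x => s [_ /=].
split; first by apply: sup_in => // s [].
  by apply: ge_sup => // s [_ /=].
by move=> s Ts ts; apply: ub_le_sup.
Qed.

Lemma tfloor_in x : T (tfloor x).
Proof.
have [xa|ax] := ltP x a; last by case: (tfloor_spec ax).
by rewrite /tfloor xa; exact: tmin_in.
Qed.

Lemma tfloor_nondecreasing : {homo tfloor : x y / x <= y}.
Proof.
move=> x y xy; have [xa|ax] := ltP x a.
  by rewrite {1}/tfloor xa; apply: tmin_le => //; exact: tfloor_in.
have [Tx xx _] := tfloor_spec ax.
have [_ _ ymax] := tfloor_spec (le_trans ax xy).
by apply: ymax => //; exact: le_trans xx xy.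
Qed.

(** For [x >= t] the value is squeezed between [t] and [x]. For [x < t] it is the constant [a] if
    [t = a]; otherwise [rho t = t] supplies points of T just below [t] that bound it from below. *)
Lemma tfloor_continuous t : T t -> ~ isolated_in T t ->
  tfloor @ t --> within T (nbhs t).
Proof.
move=> Tt nit P /nbhs_ballP[e /= e0 eP].
suff : \forall x \near t, ball t e (tfloor x).
  by apply: filterS => x tx; apply: eP => //; exact: tfloor_in.
have xr d x : t <= x -> x < t + d -> `|t - tfloor x| < d.
  move=> tx xd; have [_ xx xmax] := tfloor_spec (le_trans (tmin_le hT Tt) tx).
  by rewrite ltr_distlC; have := xmax _ Tt tx; lra.
have := tmin_le hT Tt; rewrite le_eqVlt => /orP[/eqP ta|at_].
  near=> x; rewrite /ball/=; have [tx|xt] := leP t x.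
    by apply: xr => //; near: x; apply: lt_nbhsl; rewrite ltrDl.
  by rewrite /tfloor ta xt subrr normr0.
have [s Ts /andP[s1 s2]] :=
  rho_id_adherent hT Tt at_ (not_isolated_rho hT hab hrho Tt nit) e0.
near=> x; rewrite /ball/=; have [tx|xt] := leP t x.
  by apply: xr => //; near: x; apply: lt_nbhsl; rewrite ltrDl.
have sx : s < x by near: x; exact: lt_nbhsr.
have [_ xx xmax] := tfloor_spec (le_trans (tmin_le hT Ts) (ltW sx)).
by rewrite ltr_distlC; have := xmax _ Ts (ltW sx); lra.
Unshelve. all: by end_near. Qed.

(* The Lebesgue integral of the step extension f o tfloor of f to R. *)
Lemma dantiderivative (f : R -> R) :
  (forall t, kappa_up T t -> f @ within (kappa_up T) (nbhs t) --> f t) ->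
  exists F : R -> R, forall t, kappa_up T t -> is_qderiv T (sigma t) t F (f t).
Proof.
move=> fk.
(* Only an isolated [b] is missing from [kappa_up], so continuity extends to all of T; [f] is then
   bounded and measurable on the compact set T. *)
have fc : forall t, T t -> f @ within T (nbhs t) --> f t.
  move=> t Tt; have [it|nit] := pselect (isolated_in T t).
    exact: within_isolated it.
  have kt : kappa_up T t by apply/(kappa_upP hT hab hrho); split => //; right.
  move=> P /(fk _ kt) tP.
  have {}tP : \forall s \near t, kappa_up T s -> P (f s) by exact: tP.
  have [tb|bt] := ltP t b.
    have sb : \forall s \near t, s < b by exact: lt_nbhsl.
    by apply: filterS2 tP sb => s sP sb Ts; apply/sP/kappa_up_lt.
  have tE : t = b by apply/le_anti; rewrite bt le_tmax.
  apply: filterS tP => s sP Ts; apply: sP.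
  have := le_tmax hT Ts; rewrite le_eqVlt => /orP[/eqP->|]; first by rewrite -tE.
  exact: kappa_up_lt.
have cf : {within T, continuous f} by apply/subspace_continuousP.
have cT : compact T by case: hT.
have mT := compact_measurable cT.
pose g := f \o tfloor.
have mg : measurable_fun setT g.
  apply: (measurable_comp mT) => //; first by move=> _ [x _ <-]; exact: tfloor_in.
    exact: subspace_continuous_measurable_fun.
  by apply: nondecreasing_measurable => //; exact: tfloor_nondecreasing.
have [M gM] : exists M, forall x, `|g x| <= M.
  have T0 : T !=set0 by case: hT.
  have cnf : {within T, continuous (fun x => `|f x|)}.
    by apply/subspace_continuousP => t Tt; apply: cvg_norm; exact: fc.
  have [c _ cm] := compact_EVT_max T0 cT cnf.
  by exists `|f c| => x; apply: cm; rewrite inE; exact: tfloor_in.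
pose mu := @lebesgue_measure R.
(* The margins of 1 make every point of T interior, as the two-sided derivative in the fundamental
   theorem requires. *)
have gi : mu.-integrable `[a - 1, b + 1] (EFin \o g).
  apply: measurable_bounded_integrable => //.
  - by apply: compact_finite_measure; exact: segment_compact.
  - exact: measurable_funTS.
  - exists M; split; first exact: num_real.
    by move=> y My x _ /=; exact: le_trans (gM x) (ltW My).
pose F x := \int[mu]_(y in `[a - 1, x]) g y.
exists F => t kt; have [Tt tb] := (kappa_upP hT hab hrho t).1 kt.
have at_ := tmin_le hT Tt; have tb' := le_tmax hT Tt.
have [it|nit] := pselect (isolated_in T t); last first.
  rewrite (not_isolated_sigma hT hab hsigma Tt nit).
  have gt : g t = f t.
    rewrite /g/=; congr f; have [_ tt tmax] := tfloor_spec at_.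
    by apply/le_anti; rewrite tt tmax.
  have gct : {for t, continuous g}.
    suff : g @ t --> f t by rewrite -gt.
    exact: cvg_comp (tfloor_continuous Tt nit) (fc _ Tt).
  have tb1 : t < b + 1 by lra.
  have at1 : a - 1 < t by lra.
  have [dF] := continuous_FTC1_closed tb1 gi at1 gct.
  by move=> dE; have := is_qderiv_derive1 T dF; rewrite dE gt.
have {}tb : t < b by case: tb.
have ts := isolated_lt_sigma hT Tt tb it.
have [Ts _ smin] := sigma_spec hT Tt tb.
have sb := le_tmax hT Ts.
suff -> : f t = diffq (sigma t) F t.
  by apply: is_qderiv_isolated => //; rewrite gt_eqF.
rewrite /diffq.
(* On the gap between [t] and [sigma t], [tfloor] is constantly [t], so the integrand is the
   constant [f t]. *)
have -> : F (sigma t) - F t = f t * (sigma t - t).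
  rewrite /F Rintegral_itvB ?bnd_simp; last 3 first.
  - by apply: integrableS gi => //; apply: subset_itvl; rewrite bnd_simp; lra.
  - by lra.
  - by lra.
  have its : mu.-integrable `]t, sigma t[ (EFin \o g).
    apply: integrableS gi => // x /=; rewrite !in_itv/=; lra.
  rewrite -Rintegral_itv_bndo_bndc//.
  rewrite (@eq_Rintegral _ _ _ _ _ (cst (f t))); last first.
    move=> x; rewrite inE/= in_itv/= => /andP[tx xs]; rewrite /g/=; congr f.
    have [Tx xx xmax] := tfloor_spec (le_trans at_ (ltW tx)).
    apply/le_anti/andP; split; last by apply: xmax; rewrite ?ltW.
    by rewrite leNgt; apply/negP => /(smin _ Tx); lra.
  rewrite Rintegral_cst//; congr (_ * _).
  have := @lebesgue_measure_itv R `]t, sigma t[.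
  by rewrite /= lte_fin ts -EFinD => /(congr1 fine).
by rewrite -[RHS]/(_ * _) mulrCA mulVf ?mulr1// subr_eq0 gt_eqF.
Qed.

End Integration.

(** * Symmetry of second derivatives *)

Section Line.
Context {R : realType} {V W : normedModType R}.

Lemma line_quotient (H : V -> W) z0 e s (h : R) :
  (fun s => H (z0 + s *: e)) (h *: 1 + s) - H (z0 + s *: e) =
  H (h *: e + (z0 + s *: e)) - H (z0 + s *: e).
Proof.
congr (H _ - _); rewrite -[h *: 1]/(h * 1) mulr1 scalerDl.
by rewrite addrCA.
Qed.

Lemma is_derive_line (H : V -> W) z0 e s L :
  is_derive (z0 + s *: e) e H L -> is_derive s 1 (fun s => H (z0 + s *: e)) L.
Proof.
move=> [dH <-]; split; rewrite /derivable /derive.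
  by under eq_fun do rewrite /= line_quotient.
by under eq_fun do rewrite /= line_quotient.
Qed.

Lemma is_derive_of_line (H : V -> W) z e L :
  is_derive (0 : R) 1 (fun s => H (z + s *: e)) L -> is_derive z e H L.
Proof.
have E h : (fun s => H (z + s *: e)) (h *: 1 + 0) - H (z + 0 *: e) = H (h *: e + z) - H z.
  by rewrite (line_quotient H z e 0) scale0r addr0.
move=> [dH <-]; split; rewrite /derivable /derive in dH *.
  by under eq_fun do rewrite /= -E.
by under eq_fun do rewrite /= -E.
Qed.

End Line.

(** Clairaut's theorem for directional derivatives, the only ones [hamiltonian_of] provides. The
    second difference of [H] over the square spanned by [r *: e] and [r *: f] does not depend on the
    order of the directions, so [A'] and [B'] take a common value at two points of the square;
    continuity concludes as the square shrinks. *)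
Lemma symmetric_second_derivatives (R : realType) (V : normedModType R)
    (H A B A' B' : V -> R) (e f z : V) :
  (forall x, is_derive x e H (A x)) -> (forall x, is_derive x f H (B x)) ->
  (forall x, is_derive x f A (A' x)) -> (forall x, is_derive x e B (B' x)) ->
  continuous A' -> continuous B' -> A' z = B' z.
Proof.
move=> HA HB dA dB cA cB.
(* The second difference of G over a square of side r is r^2 times a mixed
   derivative at an interior point, by the mean value theorem applied twice. *)
have key (G C C' : V -> R) (u v : V) (r : R) : 0 < r ->
    (forall x, is_derive x u G (C x)) -> (forall x, is_derive x v C (C' x)) ->
    exists s t, [/\ 0 < s < r, 0 < t < r &
      G (z + r *: u + r *: v) - G (z + r *: u) - (G (z + r *: v) - G z) =
      r * (r * C' (z + s *: u + t *: v))].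
  move=> r0 GC CC'.
  pose g s := G (z + r *: v + s *: u) - G (z + s *: u).
  have dg (s : R) : is_derive s (1 : R) g (C (z + r *: v + s *: u) - C (z + s *: u)).
    by apply: is_deriveB; exact: is_derive_line.
  have [|s s0r gE] := MVT r0 (fun s _ => dg s).
    by apply: derivable_within_continuous => s _; case: (dg s).
  pose c t := C (z + s *: u + t *: v).
  have dc (t : R) : is_derive t (1 : R) c (C' (z + s *: u + t *: v)).
    exact: is_derive_line.
  have [|t t0r cE] := MVT r0 (fun t _ => dc t).
    by apply: derivable_within_continuous => t _; case: (dc t).
  exists s, t; split; [by rewrite in_itv in s0r|by rewrite in_itv in t0r|].
  rewrite subr0 in gE; rewrite subr0 in cE.
  have -> : G (z + r *: u + r *: v) - G (z + r *: u) - (G (z + r *: v) - G z) =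
      g r - g 0.
    by rewrite /g !scale0r !addr0 [z + r *: v + _]addrAC.
  rewrite gE mulrC; congr (_ * _); rewrite [RHS]mulrC -cE /c scale0r addr0.
  by rewrite [z + r *: v + _]addrAC.
apply/eqP; rewrite -subr_eq0 -normr_le0; apply/ler_addgt0Pr => eps eps0.
rewrite add0r.
have e2 : 0 < eps / 2 by lra.
have near_line (C : V -> R) : continuous C -> exists2 d, 0 < d & forall s t : R,
    0 < s < d -> 0 < t < d -> forall u v : V, u = e /\ v = f \/ u = f /\ v = e ->
    `|C z - C (z + s *: u + t *: v)| < eps / 2.
  move=> cC; have /cvgrPdist_lt/(_ _ e2)/nbhs_ballP[d /= d0 dC] := cC z.
  (* The summand 1 keeps [m] positive when both directions are zero. *)
  pose m := `|e| + `|f| + 1.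
  have m0 : 0 < m by rewrite /m; have := normr_ge0 e; have := normr_ge0 f; lra.
  exists (d / m); first by rewrite divr_gt0.
  move=> s t /andP[s0 sd] /andP[t0 td] u v uv; apply: dC.
  rewrite -ball_normE /= -addrA opprD addrA subrr sub0r normrN.
  apply: le_lt_trans (ler_normD _ _) _; rewrite !normrZ !gtr0_norm//.
  have uvm : `|u| + `|v| < m by case: uv => -[-> ->]; rewrite /m; lra.
  have : (d / m) * (`|u| + `|v|) < d.
    by rewrite mulrAC ltr_pdivrMr// ltr_pM2l.
  apply: le_lt_trans; rewrite mulrDr lerD// ler_wpM2r// ltW//.
have [d1 d10 dA'] := near_line _ cA; have [d2 d20 dB'] := near_line _ cB.
pose r := Num.min d1 d2.
have r0 : 0 < r by rewrite lt_min d10.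
have rd1 : r <= d1 by rewrite ge_min lexx.
have rd2 : r <= d2 by rewrite ge_min lexx orbT.
have [s [t [s0 t0 E1]]] := key _ _ _ _ _ _ r0 HA dA.
have [s' [t' [s0' t0' E2]]] := key _ _ _ _ _ _ r0 HB dB.
have E : A' (z + s *: e + t *: f) = B' (z + s' *: f + t' *: e).
  have rn : r != 0 by rewrite gt_eqF.
  apply: (mulfI rn); apply: (mulfI rn); rewrite -E1 -E2 [z + r *: f + _]addrAC; ring.
have h1 : `|A' z - A' (z + s *: e + t *: f)| < eps / 2.
  by apply: dA'; [lra|lra|left].
have h2 : `|B' z - B' (z + s' *: f + t' *: e)| < eps / 2.
  by apply: dB'; [lra|lra|right].
rewrite -E in h2; rewrite distrC in h2.
have := ler_distD (A' (z + s *: e + t *: f)) (A' z) (B' z); lra.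
Qed.

(** * The Poincare lemma *)

Lemma cvg_proj1 {S} {U W : topologicalType} (G : set_system S) {FG : Filter G}
  (f : S -> U * W) (z : U * W) : f @ G --> z -> (fun s => (f s).1) @ G --> z.1.
Proof. by move=> fz; apply: (cvg_comp f fst fz); exact: cvg_fst. Qed.

Lemma cvg_proj2 {S} {U W : topologicalType} (G : set_system S) {FG : Filter G}
  (f : S -> U * W) (z : U * W) : f @ G --> z -> (fun s => (f s).2) @ G --> z.2.
Proof. by move=> fz; apply: (cvg_comp f snd fz); exact: cvg_snd. Qed.

Section PhaseSpace.
Context {R : realType} {d : nat}.
Local Notation V := ('cV[R]_d * 'cV[R]_d)%type.
Implicit Types z k h : V.

Lemma phase_basis z : z =
  \sum_i z.1 i 0 *: (delta_mx i 0, 0) + \sum_i z.2 i 0 *: (0, delta_mx i 0).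
Proof.
have colE (x : 'cV[R]_d) : x = \sum_i x i 0 *: delta_mx i 0.
  rewrite {1}(matrix_sum_delta x); apply: eq_bigr => i _.
  by rewrite big_ord1.
have fstE I (r : seq I) (f : I -> V) : (\sum_(i <- r) f i).1 = \sum_(i <- r) (f i).1.
  by elim/big_rec2 : _ => // i y1 y2 _ <-.
have sndE I (r : seq I) (f : I -> V) : (\sum_(i <- r) f i).2 = \sum_(i <- r) (f i).2.
  by elim/big_rec2 : _ => // i y1 y2 _ <-.
rewrite [LHS]surjective_pairing [RHS]surjective_pairing /= !fstE !sndE/=.
congr pair.
  rewrite [X in _ + X]big1 ?addr0; first exact: colE.
  by move=> i _; rewrite scaler0.
rewrite [X in X + _]big1 ?add0r; first exact: colE.
by move=> i _; rewrite scaler0.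
Qed.

Lemma linear_phase_basis (W : lmodType R) (f : {linear V -> W}) z : f z =
  \sum_i z.1 i 0 *: f (delta_mx i 0, 0) + \sum_i z.2 i 0 *: f (0, delta_mx i 0).
Proof.
rewrite {1}(phase_basis z) linearD !linear_sum; congr (_ + _);
  by apply: eq_bigr => i _; rewrite linearZ.
Qed.

(** [C1_map] gives continuity of the differential for each fixed direction. Expanding a moving
    direction in the finite basis reduces joint continuity to it. *)
Lemma cvg_diff (F : V -> 'cV[R]_d) (S : Type) (G : set_system S) {FG : Filter G}
    (zf kf : S -> V) z k : C1_map F -> zf @ G --> z -> kf @ G --> k ->
  (fun s => 'd F (zf s) (kf s)) @ G --> 'd F z k.
Proof.
move=> [_ cF] zz kk.
(* Rewriting with terms in 'd diverges, hence the abstraction over D. *)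
suff H (D : V -> V -> 'cV[R]_d) : (forall h, continuous (D ^~ h)) ->
    (forall x h, D x h = \sum_i h.1 i 0 *: D x (delta_mx i 0, 0) +
      \sum_i h.2 i 0 *: D x (0, delta_mx i 0)) ->
    (fun s => D (zf s) (kf s)) @ G --> D z k.
  exact: (H (fun x h => 'd F x h) cF (fun x => linear_phase_basis ('d F x))).
move=> cD DE; rewrite DE; under eq_fun do rewrite DE.
have k1 : (fun s => (kf s).1) @ G --> k.1 by exact: cvg_proj1.
have k2 : (fun s => (kf s).2) @ G --> k.2 by exact: cvg_proj2.
have add_cont : continuous (fun x : 'cV[R]_d * 'cV[R]_d => x.1 + x.2).
  by move=> x; apply: cvgD; [exact: cvg_fst|exact: cvg_snd].
apply: cvgD; apply: cvg_big => // i _; apply: cvgZ; try exact: cvg_coord.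
  exact: (cvg_comp zf (D ^~ _) zz (cD _ z)).
exact: (cvg_comp zf (D ^~ _) zz (cD _ z)).
Qed.

Variables Xq Xp : V -> 'cV[R]_d.
Hypotheses (hXq : C1_map Xq) (hXp : C1_map Xp).

(* H is a Hamiltonian of X iff dH = Xform. *)
Definition Xform z h : R := dotp h.2 (Xq z) - dotp h.1 (Xp z).

Definition dXform z k h : R := dotp h.2 ('d Xq z k) - dotp h.1 ('d Xp z k).

Lemma XformD z h h' : Xform z (h + h') = Xform z h + Xform z h'.
Proof. by rewrite /Xform !dotpDl opprD addrACA. Qed.

Lemma XformZ z c h : Xform z (c *: h) = c * Xform z h.
Proof. by rewrite /Xform !dotpZl mulrBr. Qed.

Lemma dXformDr z k h h' : dXform z k (h + h') = dXform z k h + dXform z k h'.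
Proof. by rewrite /dXform !dotpDl opprD addrACA. Qed.

Lemma dXformZr z k c h : dXform z k (c *: h) = c * dXform z k h.
Proof. by rewrite /dXform !dotpZl mulrBr. Qed.

Lemma dXformDl z k k' h : dXform z (k + k') h = dXform z k h + dXform z k' h.
Proof.
have Dq : 'd Xq z (k + k') = 'd Xq z k + 'd Xq z k' by exact: raddfD.
have Dp : 'd Xp z (k + k') = 'd Xp z k + 'd Xp z k' by exact: raddfD.
apply: (etrans (congr2 (fun x y => dotp h.2 x - dotp h.1 y) Dq Dp)).
by rewrite !dotpDr opprD addrACA.
Qed.

Lemma dXformZl z k c h : dXform z (c *: k) h = c * dXform z k h.
Proof.
have Dq : 'd Xq z (c *: k) = c *: 'd Xq z k by exact: linearZ.
have Dp : 'd Xp z (c *: k) = c *: 'd Xp z k by exact: linearZ.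
apply: (etrans (congr2 (fun x y => dotp h.2 x - dotp h.1 y) Dq Dp)).
by rewrite !dotpZr mulrBr.
Qed.

Lemma cvg_Xform (S : Type) (G : set_system S) {FG : Filter G}
    (zf hf : S -> V) z h : zf @ G --> z -> hf @ G --> h ->
  (fun s => Xform (zf s) (hf s)) @ G --> Xform z h.
Proof.
move=> zz kk.
have k1 : (fun s => (hf s).1) @ G --> h.1 by exact: cvg_proj1.
have k2 : (fun s => (hf s).2) @ G --> h.2 by exact: cvg_proj2.
apply: cvgB; apply: cvg_dotp => //.
  exact: (cvg_comp zf Xq zz (differentiable_continuous (hXq.1 z))).
exact: (cvg_comp zf Xp zz (differentiable_continuous (hXp.1 z))).
Qed.

Lemma cvg_dXform (S : Type) (G : set_system S) {FG : Filter G}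
    (zf kf hf : S -> V) z k h : zf @ G --> z -> kf @ G --> k -> hf @ G --> h ->
  (fun s => dXform (zf s) (kf s) (hf s)) @ G --> dXform z k h.
Proof.
move=> zz kk hh.
have k1 : (fun s => (hf s).1) @ G --> h.1 by exact: cvg_proj1.
have k2 : (fun s => (hf s).2) @ G --> h.2 by exact: cvg_proj2.
by apply: cvgB; apply: cvg_dotp => //; apply: cvg_diff.
Qed.

Lemma is_derive_dotp (U : normedModType R) (Y : U -> 'cV[R]_d) w
    (z k : U) L :
  is_derive z k Y L -> is_derive z k (fun x => dotp w (Y x)) (dotp w L).
Proof.
move=> [dY <-].
have dw : (fun h : R => h^-1 *: (dotp w (Y (h *: k + z)) - dotp w (Y z))) @
    0^' --> dotp w ('D_k Y z).
  under eq_fun do rewrite -dotpBr -[_ *: dotp _ _]/(_ * _) -dotpZr.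
  by apply: cvg_dotp => //; exact: cvg_cst.
by split; [apply/cvg_ex; exists (dotp w ('D_k Y z))|exact: cvg_lim].
Qed.

Lemma is_derive_diff (F : V -> 'cV[R]_d) z k : C1_map F ->
  is_derive z k F ('d F z k).
Proof.
move=> [dF _]; have := dF z; split; first exact: diff_derivable.
by rewrite deriveE.
Qed.

Lemma is_derive_Xform z k h : is_derive z k (Xform ^~ h) (dXform z k h).
Proof.
by apply: is_deriveB; apply: is_derive_dotp; exact: is_derive_diff.
Qed.

Definition dXform_symmetric := forall z k h, dXform z k h = dXform z h k.

(** [hamiltonian_of] constrains [H] along basis vectors only, so Clairaut gives symmetry on pairs of
    them; bilinearity extends it to one argument at a time. *)
Lemma hamiltonian_dXform_symmetric H : hamiltonian_of Xq Xp H ->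
  dXform_symmetric.
Proof.
move=> hH.
have HE (i : 'I_d) z : is_derive z (0, delta_mx i 0) H (Xform z (0, delta_mx i 0)).
  by rewrite /Xform dotp0l subr0 dotp_deltal; exact: (hH z i).1.
have HF (i : 'I_d) z : is_derive z (delta_mx i 0, 0) H (Xform z (delta_mx i 0, 0)).
  by rewrite /Xform dotp0l sub0r dotp_deltal; exact: (hH z i).2.
have sym e f : (forall z, is_derive z e H (Xform z e)) ->
    (forall z, is_derive z f H (Xform z f)) ->
    forall z, dXform z e f = dXform z f e.
  move=> He Hf z.
  apply: (symmetric_second_derivatives (H := H) (A := Xform ^~ f) (B := Xform ^~ e)
    (A' := fun z => dXform z e f) (B' := fun z => dXform z f e) (e := f) (f := e)) => //.
  - by move=> x; exact: is_derive_Xform.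
  - by move=> x; exact: is_derive_Xform.
  - by move=> x; apply: cvg_dXform => //; exact: cvg_cst.
  - by move=> x; apply: cvg_dXform => //; exact: cvg_cst.
have sumr z k I (r : seq I) (c : I -> R) (f : I -> V) :
    dXform z k (\sum_(i <- r) c i *: f i) = \sum_(i <- r) c i * dXform z k (f i).
  elim/big_rec2 : _ => [|i y x _ <-]; first by rewrite -(scale0r 0) dXformZr mul0r.
  by rewrite dXformDr dXformZr.
have suml z k I (r : seq I) (c : I -> R) (f : I -> V) :
    dXform z (\sum_(i <- r) c i *: f i) k = \sum_(i <- r) c i * dXform z (f i) k.
  elim/big_rec2 : _ => [|i y x _ <-]; first by rewrite -(scale0r 0) dXformZl mul0r.
  by rewrite dXformDl dXformZl.
have symb z e k : (forall z, is_derive z e H (Xform z e)) ->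
    dXform z k e = dXform z e k.
  move=> He; rewrite (phase_basis k) dXformDl dXformDr !sumr !suml.
  by congr (_ + _); apply: eq_bigr => i _; congr (_ * _); apply: sym.
move=> z k h; rewrite (phase_basis h) dXformDl dXformDr !sumr !suml.
by congr (_ + _); apply: eq_bigr => i _; congr (_ * _); apply: symb.
Qed.

Lemma canonicalHE z : canonicalH Xq Xp z =
  \int[lebesgue_measure]_(l in `[0, 1]) Xform (l *: z) z.
Proof. by []. Qed.

Lemma is_derive_canonicalH z e : dXform_symmetric ->
  is_derive z e (canonicalH Xq Xp) (Xform z e).
Proof.
move=> sym; apply: is_derive_of_line.
(* This is [l *: (z + s *: e)], arranged as a line in [s] with direction [l *: e]. *)
pose p s l : V := l *: z + s *: (l *: e).
pose f s l := Xform (p s l) z + s * Xform (p s l) e.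
pose D s l := l * dXform (p s l) e (z + s *: e) + Xform (p s l) e.
have HE : (fun s => canonicalH Xq Xp (z + s *: e)) =
    (fun s => \int[lebesgue_measure]_(l in `[0, 1]) f s l).
  apply/funext => s; rewrite canonicalHE; apply: eq_Rintegral => l _.
  rewrite /f -XformZ -XformD; congr (Xform _ _).
  by rewrite /p scalerDr !scalerA [l * s]mulrC.
have df (s l : R) : is_derive s (1 : R) (f ^~ l) (D s l).
  have dX h : is_derive s (1 : R) (fun s => Xform (p s l) h) (dXform (p s l) (l *: e) h).
    exact: (@is_derive_line _ _ _ (Xform ^~ h)) (is_derive_Xform _ _ _).
  apply: (is_derive_eq (is_deriveD (dX z) (is_deriveM (is_derive_id _ _) (dX e)))).
  rewrite /D dXformDr dXformZr !dXformZl -!/(_ * _) /=.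
  rewrite -[s *: _]/(s * _) -[_ *: 1]/(_ * 1); ring.
have cp : continuous (fun x : R * R => p x.1 x.2).
  move=> x; apply: cvgD; apply: cvgZ.
  - exact: cvg_snd.
  - exact: cvg_cst.
  - exact: cvg_fst.
  - by apply: cvgZ; [exact: cvg_snd|exact: cvg_cst].
have cD : continuous (fun x : R * R => D x.1 x.2).
  move=> x; apply: cvgD; last by apply: cvg_Xform; [exact: cp|exact: cvg_cst].
  apply: cvgM; first exact: cvg_snd.
  apply: cvg_dXform; [exact: cp|exact: cvg_cst|].
  apply: cvgD; first exact: cvg_cst.
  by apply: cvgZ; [exact: cvg_fst|exact: cvg_cst].
(* A constant dominating the [s]-derivative on a compact rectangle allows differentiation under the
   integral at [s = 0]. *)
have [M MP] : exists M, forall s l, -1 <= s <= 1 -> 0 <= l <= 1 -> `|D s l| <= M.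
  have cA := compact_setX (@segment_compact R (-1) 1) (@segment_compact R 0 1).
  have [||c _ cm] := @compact_EVT_max _ R (fun x => `|D x.1 x.2|) _ _ cA.
  - by exists (0, 0); split; rewrite /= in_itv/=; lra.
  - apply: continuous_subspaceT => x; apply: cvg_norm; exact: cD.
  - exists `|D c.1 c.2| => s l sI lI; apply: (cm (s, l)).
    by rewrite inE; split; rewrite /= in_itv.
have cf s : continuous (f s).
  move=> l.
  have cps : p s l' @[l' --> l] --> p s l.
    apply: cvgD; first by apply: cvgZ; [exact: cvg_id|exact: cvg_cst].
    apply: cvgZ; first exact: cvg_cst.
    by apply: cvgZ; [exact: cvg_id|exact: cvg_cst].
  apply: cvgD; first by apply: cvg_Xform => //; exact: cvg_cst.
  apply: cvgM; first exact: cvg_cst.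
  by apply: cvg_Xform => //; exact: cvg_cst.
pose mu := @lebesgue_measure R.
have ii s : (`]-1, 1[%classic : set R) s -> mu.-integrable `[0, 1] (EFin \o f s).
  move=> _; apply: continuous_compact_integrable; first exact: segment_compact.
  exact: continuous_subspaceT.
have I0 : (`]-1, 1[%classic : set R) 0 by rewrite /= in_itv/=; lra.
have dfE s l : partial1of2 f s l = D s l by rewrite partial1of2E; exact: derive_val.
have m01 : measurable (`[0, 1]%classic : set (measurableTypeR R)).
  exact: measurable_itv.
have M0 (l : R) : 0 <= M.
  by apply: le_trans (normr_ge0 _) (MP 0 0 _ _); lra.
have iM : mu.-integrable `[0, 1] (EFin \o (fun=> M)).
  apply: continuous_compact_integrable; first exact: segment_compact.
  by apply: continuous_subspaceT => x; exact: cvg_cst.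
have fM s l : (`]-1, 1[%classic : set R) s -> (`[0, 1]%classic : set R) l ->
    `|partial1of2 f s l| <= M.
  by rewrite /= !in_itv/= dfE => /andP[s1 s2] lI; apply: MP => //; rewrite !ltW.
have fd s l : (`]-1, 1[%classic : set R) s -> (`[0, 1]%classic : set R) l ->
    derivable (f ^~ l) s 1.
  by move=> _ _; case: (df s l).
have DF := derivable_under_integral m01 I0 ii fd M0 iM fM.
have VF := differentiation_under_integral m01 I0 ii fd M0 iM fM.
rewrite HE; split => //; rewrite -derive1E VF.
(* Symmetry exchanges [e] and [z] in [dXform (l *: z) e z], which becomes a derivative along the ray
   through [z]; the integrand is then the derivative of [l * Xform (l *: z) e]. *)
transitivity (\int[lebesgue_measure]_(l in `[0, 1])
    (l * dXform (l *: z) z e + Xform (l *: z) e)).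
  by apply: eq_Rintegral => l _; rewrite /= dfE /D /p !scale0r !addr0 sym.
pose F (l : R) := l * Xform (l *: z) e.
have dF (l : R) : is_derive l (1 : R) F (l * dXform (l *: z) z e + Xform (l *: z) e).
  have dX : is_derive l (1 : R) (fun l : R => Xform (l *: z) e) (dXform (l *: z) z e).
    have := @is_derive_line _ _ _ (Xform ^~ e) 0 z l _ (is_derive_Xform _ _ _).
    by rewrite add0r; under [X in is_derive _ _ X _]eq_fun do rewrite add0r.
  apply: (is_derive_eq (is_deriveM (is_derive_id _ _) dX)).
  by congr (_ + _); exact: mulr1.
have cF : continuous F.
  by move=> l; apply/differentiable_continuous/derivable1_diffP; case: (dF l).
have cdF : continuous (fun l : R => l * dXform (l *: z) z e + Xform (l *: z) e).
  move=> l; have cl : l' *: z @[l' --> l] --> l *: z.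
    by apply: cvgZ; [exact: cvg_id|exact: cvg_cst].
  apply: cvgD; last by apply: cvg_Xform => //; exact: cvg_cst.
  by apply: cvgM => //; apply: cvg_dXform => //; exact: cvg_cst.
rewrite /Rintegral (@continuous_FTC2 _ _ F) //=.
- by rewrite /F scale1r mul1r mul0r subr0.
- exact: continuous_subspaceT.
- split; first by move=> l _; case: (dF l).
  + exact: cvg_at_right_filter (cF 0).
  + exact: cvg_at_left_filter (cF 1).
- by move=> l _; rewrite derive1E; exact: derive_val.
Qed.

End PhaseSpace.

(** * The symplectic adjoint *)

Lemma cvg_mx {R : realType} {S : Type} (F : set_system S) {FF : Filter F} m n
    (f : S -> 'M[R]_(m, n)) (l : 'M[R]_(m, n)) :
  (forall i j, (fun s => f s i j) @ F --> l i j) -> f @ F --> l.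
Proof.
move=> fl A [P PN PA].
have : \forall s \near F, forall ij : 'I_m * 'I_n, P ij.1 ij.2 (f s ij.1 ij.2).
  by apply: filter_forall => -[i j]; apply: fl; exact: PN.
by apply: filterS => s sP; apply: PA => i j; exact: (sP (i, j)).
Qed.

Lemma cvg_col_mx {R : realType} {S : Type} (F : set_system S) {FF : Filter F} n
    (f g : S -> 'cV[R]_n) (l m : 'cV[R]_n) :
  f @ F --> l -> g @ F --> m ->
  (fun s => col_mx (f s) (g s)) @ F --> col_mx l m.
Proof.
move=> fl gm; apply: cvg_mx => i j; rewrite (ord1 j).
case: (split_ordP i) => k ->.
  by rewrite col_mxEu; under eq_fun do rewrite col_mxEu; exact: cvg_coord.
by rewrite col_mxEd; under eq_fun do rewrite col_mxEd; exact: cvg_coord.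
Qed.

Lemma is_derive_col_mx {R : realType} {V : normedModType R} n
    (f g : V -> 'cV[R]_n) (s v : V) (L M : 'cV[R]_n) :
  is_derive s v f L -> is_derive s v g M ->
  is_derive s v (fun x => col_mx (f x) (g x)) (col_mx L M).
Proof.
move=> [df <-] [dg <-].
have dfg : (fun h : R => h^-1 *: (col_mx (f (h *: v + s)) (g (h *: v + s)) -
    col_mx (f s) (g s))) @ 0^' --> col_mx ('D_v f s) ('D_v g s).
  under eq_fun do rewrite opp_col_mx add_col_mx scale_col_mx.
  exact: cvg_col_mx df dg.
by split; [apply/cvg_ex; eexists; exact: dfg|exact: cvg_lim].
Qed.

(** Without a middle point, an injection of three indices into T would take only the two values
    [tmin T] and [tmax T]. *)
Lemma card3_middle (R : realType) (T : set R) : bounded_time_scale T ->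
  (`I_3 #<= T)%card -> exists2 t, T t & tmin T < t < tmax T.
Proof.
move=> hT /pcard_leP[f].
have fT i : (i < 3)%N -> T (f i) by move=> i3; apply: (@funS _ _ _ _ f).
have finj i j : (i < 3)%N -> (j < 3)%N -> f i = f j -> i = j.
  by move=> i3 j3; apply: (@inj _ _ `I_3 f); rewrite inE.
have mid t : T t -> t != tmin T -> t != tmax T -> tmin T < t < tmax T.
  move=> Tt ta tb; rewrite !lt_neqAle tb [tmin T == _]eq_sym ta/=.
  by rewrite tmin_le//= le_tmax.
apply: contrapT => nt.
have ab i : (i < 3)%N -> f i = tmin T \/ f i = tmax T.
  move=> i3; have [->|fa] := eqVneq (f i) (tmin T); first by left.
  have [->|fb] := eqVneq (f i) (tmax T); first by right.
  by exfalso; apply: nt; exists (f i); [exact: fT|exact: mid (fT _ i3) fa fb].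
have n01 : f 0%N <> f 1%N by move=> /(finj 0%N 1%N isT isT).
have n02 : f 0%N <> f 2%N by move=> /(finj 0%N 2%N isT isT).
have n12 : f 1%N <> f 2%N by move=> /(finj 1%N 2%N isT isT).
have := ab 0%N isT; have := ab 1%N isT; have := ab 2%N isT.
move=> [e2|e2] [e1|e1] [e0|e0]; rewrite ?e0 ?e1 ?e2 in n01 n02 n12; by [].
Qed.

Section Main.
Context {R : realType} (T : set R) {d : nat}.
Hypothesis hT : bounded_time_scale T.

Local Notation a := (tmin T).
Local Notation b := (tmax T).
Local Notation sigma := (sigma T).
Local Notation rho := (rho T).
Local Notation V := ('cV[R]_d * 'cV[R]_d)%type.

Hypothesis hab : a < b.
Hypothesis hrho : forall t, kappa_up T t -> dderivable T rho t.
Hypothesis hsigma : forall t, kappa_dn T t -> nderivable T sigma t.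

Variables Xq Xp : V -> 'cV[R]_d.
Hypotheses (hXq : C1_map Xq) (hXp : C1_map Xp).

(** By uniqueness of quotient limits, the time scale derivatives of the perturbed pair are affine in
    [e]; only [X] needs the chain rule. *)
Lemma opDOE (f h : pair_fun) t : C1dn T f -> C1dn T h ->
  kappa_up T t -> kappa_dn T t ->
  opDO T Xq Xp f h t =
  col_mx (dderive T h.1 t - 'd Xq (f.1 t, f.2 t) (h.1 t, h.2 t))
    (dderive T rho t *: nderive T h.2 t - 'd Xp (f.1 t, f.2 t) (h.1 t, h.2 t)).
Proof.
move=> [[f1 _] [f2 _]] [[h1 _] [h2 _]] kut kdt.
pose z : V := (f.1 t, f.2 t); pose k : V := (h.1 t, h.2 t).
rewrite /opDO (_ : (fun e : R => _) = fun e : R => col_mx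
    (dderive T f.1 t + e *: dderive T h.1 t - Xq (z + e *: k))
    (dderive T rho t *: (nderive T f.2 t + e *: nderive T h.2 t) -
       Xp (z + e *: k))); last first.
  apply/funext => e; rewrite /opO /=.
  have -> : dderive T (fun s => f.1 s + e *: h.1 s) t =
      dderive T f.1 t + e *: dderive T h.1 t.
    apply: (dderive_eq hT hab hrho kut _).2.
    apply: is_qderivD; first exact: dderivable_qderiv (f1 _ kut).
    exact: is_qderivZ (dderivable_qderiv (h1 _ kut)).
  have -> // : nderive T (fun s => f.2 s + e *: h.2 s) t =
      nderive T f.2 t + e *: nderive T h.2 t.
  apply: (nderive_eq hT hab hsigma kdt _).2.
  apply: is_qderivD; first exact: nderivable_qderiv (f2 _ kdt).
  exact: is_qderivZ (nderivable_qderiv (h2 _ kdt)).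
have affine (x y : 'cV[R]_d) : is_derive (0 : R) (1 : R) (fun e : R => x + e *: y) y.
  have := @is_derive_line _ _ _ (fun y : 'cV[R]_d => y) x y 0 y.
  by apply; exact: is_derive_id.
have dX (F : V -> 'cV[R]_d) : C1_map F ->
    is_derive (0 : R) (1 : R) (fun e : R => F (z + e *: k)) ('d F z k).
  move=> hF; apply: is_derive_line; rewrite scale0r addr0.
  exact: is_derive_diff.
rewrite derive1E; apply: (@derive_val _ _ _ _ _ _ _ _).
by apply: is_derive_col_mx; apply: is_deriveB (dX _ _).
Qed.

Definition sympl_integrand (f h k : pair_fun) (t : R) : R :=
  if t \in kappa_dn T then
    dotp (opDO T Xq Xp f h t) (symplJ R d *m joint k t) else 0.

Lemma sympl_integrandE (f h k : pair_fun) t : C1dn T f -> C1dn T h ->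
  kappa_up T t -> sympl_integrand f h k t =
  if t \in kappa_dn T then
    dotp (dderive T h.1 t) (k.2 t) -
    dotp (k.1 t) (dderive T rho t *: nderive T h.2 t) -
    dXform Xq Xp (f.1 t, f.2 t) (h.1 t, h.2 t) (k.1 t, k.2 t) else 0.
Proof.
move=> hf hh kt; rewrite /sympl_integrand; case: ifPn => // /set_mem kdt.
have split_dotp (u A y v B x : 'cV[R]_d) :
    dotp (u - A) y - dotp (v - B) x =
    dotp u y - dotp x v - (dotp y A - dotp x B).
  by rewrite !dotpBl [dotp A _]dotpC [dotp v _]dotpC [dotp B _]dotpC; ring.
rewrite opDOE// /joint dotp_col_mx; exact: split_dotp.
Qed.

(** The boundary term of the integration by parts. *)
Let L0 (u x : R -> 'cV[R]_d) t := dotp (u t) (x (rho t)).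

Lemma dXform_symmetric_self_adjoint : dXform_symmetric Xq Xp ->
  forall qp : pair_fun, C1dn T qp -> self_adjoint T (opDO T Xq Xp qp).
Proof.
move=> sym qp hqp h k [hh [ha1 hb1 ha2 hb2]] [hk [ka1 kb1 ka2 kb2]].
have [[dq _] [dp _]] := hqp.
have [[dh1 ch1] [dh2 _]] := hh; have [[dk1 ck1] [dk2 _]] := hk.
(* The integrand of the product of [DO h] with [k], plus the Delta-derivative of [L0 k.1 h.2]. No
   [rho^Delta] or nabla-derivative is left, so it is continuous, and by [sym] it is unchanged when
   [h] and [k] are exchanged: one antiderivative [G] serves both products. *)
pose g0 t := dotp (dderive T h.1 t) (k.2 t) + dotp (dderive T k.1 t) (h.2 t) -
  dXform Xq Xp (qp.1 t, qp.2 t) (h.1 t, h.2 t) (k.1 t, k.2 t).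
pose g t := if t \in kappa_dn T then g0 t else 0.
have [|G dG] := @dantiderivative _ _ hT hab hrho hsigma g.
  move=> t kt; have [Tt _] := kt.
  have [it|nit] := pselect (isolated_in T t).
    by apply: within_isolated it => s [].
  have kdt : kappa_dn T t.
    by apply/(kappa_dnP hT hab hsigma); split => //; right.
  have gt : g t = g0 t by rewrite /g mem_set.
  have FF : Filter (within (kappa_up T) (nbhs t)) by exact: within_filter.
  have upT (W : normedModType R) (u : R -> W) : u @ within T (nbhs t) --> u t ->
      u @ within (kappa_up T) (nbhs t) --> u t.
    by apply: cvg_trans; apply: cvg_app; apply: within_subset => s [].
  have c1 u : (forall t, kappa_up T t -> dderivable T u t) ->
      (u : R -> 'cV[R]_d) @ within (kappa_up T) (nbhs t) --> u t.
    by move=> du; apply: upT; exact: (dderivable_continuous hT hab hrho).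
  have c2 u : (forall t, kappa_dn T t -> nderivable T u t) ->
      (u : R -> 'cV[R]_d) @ within (kappa_up T) (nbhs t) --> u t.
    by move=> du; apply: upT; exact: (nderivable_continuous hT hab hsigma).
  have g0c : g0 @ within (kappa_up T) (nbhs t) --> g0 t.
    have rdc (u : R -> 'cV[R]_d) := (rd_continuousP hT hab hsigma u).1.
    apply: cvgB.
      apply: cvgD; apply: cvg_dotp; [exact: rdc|exact: c2|exact: rdc|exact: c2].
    have pairc (u x : R -> 'cV[R]_d) : u @ within (kappa_up T) (nbhs t) --> u t ->
        x @ within (kappa_up T) (nbhs t) --> x t ->
        (fun s => (u s, x s)) @ within (kappa_up T) (nbhs t) --> (u t, x t).
      by move=> uc xc; apply: (@cvg_pair _ _ _ _ (nbhs (u t)) (nbhs (x t))).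
    exact: (cvg_dXform hXq hXp (pairc _ _ (c1 _ dq) (c2 _ dp))
      (pairc _ _ (c1 _ dh1) (c2 _ dh2)) (pairc _ _ (c1 _ dk1) (c2 _ dk2))).
  rewrite gt; apply: cvg_trans g0c; apply: near_eq_cvg.
  (* [g] and [g0] can differ on T only at an isolated [a], which is not [t]; so they agree near
     [t]. *)
  have [ta|ta] := eqVneq t a.
    apply: filterS (withinT _ _) => s [Ts _]; rewrite /g mem_set//.
    have [//|[sa]] := kappa_dn_cases hT hab hsigma Ts.
    by rewrite sa -ta.
  have na : \forall s \near within (kappa_up T) (nbhs t), s != a.
    exact: cvg_within (near_neq ta).
  apply: filterS2 (withinT _ _) na => s [Ts _] sa; rewrite /g mem_set//.
  have [//|[sE]] := kappa_dn_cases hT hab hsigma Ts.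
  by rewrite sE eqxx in sa.
have bnd (u x : R -> 'cV[R]_d) : u a = 0 -> u b = 0 -> L0 u x b = 0 /\ L0 u x a = 0.
  by move=> ua ub; rewrite /L0 ua ub !dotp0l.
have [E1 E2] := bnd k.1 h.2 ka1 kb1; have [E3 E4] := bnd h.1 k.2 ha1 hb1.
exists (G b - G a); split.
- exists (fun t => G t - L0 k.1 h.2 t); split; last by rewrite E1 E2 !subr0.
  move=> t kt.
  apply: (dderive_eq hT hab hrho kt).
  have := is_qderivB (dG _ kt) (is_qderiv_dotp_rho hT hab hrho hsigma dk1 dh2 ha2 kt).
  congr is_qderiv.
  rewrite -/(sympl_integrand _ _ _ _) sympl_integrandE// /g.
  by case: ifP => _; rewrite ?subr0// /g0; ring.
- exists (fun t => G t - L0 h.1 k.2 t); split; last by rewrite E3 E4 !subr0.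
  move=> t kt.
  apply: (dderive_eq hT hab hrho kt).
  have := is_qderivB (dG _ kt) (is_qderiv_dotp_rho hT hab hrho hsigma dh1 dk2 ka2 kt).
  congr is_qderiv.
  rewrite -/(sympl_integrand _ _ _ _) sympl_integrandE// /g.
  by case: ifP => _; rewrite ?subr0// /g0 sym; ring.
Qed.

(** * Test pairs and the converse implication *)

Definition bump (t : R) : R := (t - a) * (b - t).

(** As [bump] is quadratic, its quotient between [c] and [s] is exactly [a + b - (c + s)], whatever
    T is. *)
Lemma is_qderiv_bump c t : is_qderiv T c t (bump : R -> R^o) (a + b - (c + t)).
Proof.
have FF : Filter (qfilter T c t) by exact: within_filter.
have : (fun s : R => a + b - (c + s)) @ qfilter T c t --> a + b - (c + t).
  apply: cvgB; first exact: cvg_cst.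
  by apply: cvgD; [exact: cvg_cst|exact: cvg_within].
apply: cvg_trans; apply: near_eq_cvg.
apply: filterS (withinT _ _) => s [_ /= sc].
rewrite /diffq -[RHS]/(_ * _) /bump; field.
by rewrite subr_eq0 eq_sym.
Qed.

Lemma is_qderivZr c t (phi : R -> R) (e : 'cV[R]_d) (L : R) :
  is_qderiv T c t phi L -> is_qderiv T c t (fun s => phi s *: e) (L *: e).
Proof.
move=> pL; rewrite /is_qderiv.
have FF : Filter (qfilter T c t) by exact: within_filter.
have -> : diffq c (fun s => phi s *: e) = (fun s => diffq c phi s *: e).
  by apply/funext => s; rewrite /diffq -scalerBl scalerA.
by apply: cvgZ => //; exact: cvg_cst.
Qed.

(** The Delta-derivative involves [sigma], which is continuous on T because it is
    nabla-differentiable. *)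
Lemma bump_C1_rd (e : 'cV[R]_d) : C1_rd T (fun t => bump t *: e).
Proof.
have db t : kappa_up T t -> dderivable T (fun t => bump t *: e) t /\
    dderive T (fun t => bump t *: e) t = (a + b - (sigma t + t)) *: e.
  by move=> kt; apply: (dderive_eq hT hab hrho kt); apply/is_qderivZr/is_qderiv_bump.
split; first by move=> t /db[].
apply/(rd_continuousP hT hab hsigma) => t kt; have [Tt _] := kt.
have FF : Filter (within (kappa_up T) (nbhs t)) by exact: within_filter.
rewrite (db _ kt).2.
have : (fun s => (a + b - (sigma s + s)) *: e) @ within (kappa_up T) (nbhs t) -->
    (a + b - (sigma t + t)) *: e.
  apply: cvgZ; last exact: cvg_cst.
  apply: cvgB; first exact: cvg_cst.
  apply: cvgD; last exact: cvg_within.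
  apply: cvg_trans (nderivable_continuous hT hab hsigma hsigma Tt).
  by apply: cvg_app; apply: within_subset => ? [].
apply: cvg_trans; apply: near_eq_cvg.
by apply: filterS (withinT _ _) => s ks; rewrite (db _ ks).2.
Qed.

Lemma bump_C1_ld (e : 'cV[R]_d) : C1_ld T (fun t => bump t *: e).
Proof.
have db t : kappa_dn T t -> nderivable T (fun t => bump t *: e) t /\
    nderive T (fun t => bump t *: e) t = (a + b - (rho t + t)) *: e.
  by move=> kt; apply: (nderive_eq hT hab hsigma kt); apply/is_qderivZr/is_qderiv_bump.
split; first by move=> t /db[].
apply/(ld_continuousP hT hab hrho) => t kt; have [Tt _] := kt.
have FF : Filter (within (kappa_dn T) (nbhs t)) by exact: within_filter.
rewrite (db _ kt).2.
have : (fun s => (a + b - (rho s + s)) *: e) @ within (kappa_dn T) (nbhs t) -->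
    (a + b - (rho t + t)) *: e.
  apply: cvgZ; last exact: cvg_cst.
  apply: cvgB; first exact: cvg_cst.
  apply: cvgD; last exact: cvg_within.
  apply: cvg_trans (dderivable_continuous hT hab hrho hrho Tt).
  by apply: cvg_app; apply: within_subset => ? [].
apply: cvg_trans; apply: near_eq_cvg.
by apply: filterS (withinT _ _) => s ks; rewrite (db _ ks).2.
Qed.

Lemma cst_C1dn (z : V) : C1dn T ((fun=> z.1), (fun=> z.2)).
Proof.
split; split => /=.
- by move=> t kt; apply: (dderive_eq hT hab hrho kt (is_qderiv_cst _ _ _ _)).1.
- apply/(rd_continuousP hT hab hsigma) => t kt.
  have d0 s : kappa_up T s -> dderive T (fun=> z.1) s = 0.
    by move=> ks; apply: (dderive_eq hT hab hrho ks (is_qderiv_cst _ _ _ _)).2.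
  have : (fun=> 0) @ within (kappa_up T) (nbhs t) --> dderive T (fun=> z.1) t.
    by rewrite d0//; exact: cvg_cst.
  apply: cvg_trans; apply: near_eq_cvg.
  by apply: filterS (withinT _ _) => s ks; rewrite d0.
- by move=> t kt; apply: (nderive_eq hT hab hsigma kt (is_qderiv_cst _ _ _ _)).1.
- apply/(ld_continuousP hT hab hrho) => t kt.
  have d0 s : kappa_dn T s -> nderive T (fun=> z.2) s = 0.
    by move=> ks; apply: (nderive_eq hT hab hsigma ks (is_qderiv_cst _ _ _ _)).2.
  have : (fun=> 0) @ within (kappa_dn T) (nbhs t) --> nderive T (fun=> z.2) t.
    by rewrite d0//; exact: cvg_cst.
  apply: cvg_trans; apply: near_eq_cvg.
  by apply: filterS (withinT _ _) => s ks; rewrite d0.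
Qed.

(** [L] is nondecreasing with equal end values, hence constant on T, and uniqueness of the
    derivative gives 0. This stands in for the vanishing of a nonnegative function of zero
    integral. *)
Lemma qderiv_ge0_eq0 (L f : R -> R) t0 : L a = L b ->
  (forall t, kappa_up T t -> is_qderiv T (sigma t) t L (f t) /\ 0 <= f t) ->
  kappa_up T t0 -> f t0 = 0.
Proof.
move=> Lab dL k0.
have Lcst t : T t -> L t = L a.
  move=> Tt; have mono := qderiv_ge0_nondecreasing hT hab hrho hsigma dL.
  apply/le_anti/andP; split.
    by rewrite Lab; apply: mono => //; [exact: tmax_in|exact: le_tmax].
  by apply: mono => //; [exact: tmin_in|exact: tmin_le].
have [Tt0 PF] := kappa_up_proper hT hab hrho k0.
apply: (is_qderiv_unique Tt0 PF (dL _ k0).1).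
apply: is_qderiv_eq (is_qderiv_cst T (sigma t0) t0 (L a)); first exact: sigma_in.
by move=> t /set_mem Tt; rewrite Lcst.
Qed.

Lemma self_adjoint_dXform_symmetric : (exists2 t, T t & a < t < b) ->
  (forall qp : pair_fun, C1dn T qp -> self_adjoint T (opDO T Xq Xp qp)) ->
  dXform_symmetric Xq Xp.
Proof.
move=> [t0 Tt0 /andP[at0 t0b]] sa z k0 h0.
pose bp (e : V) : pair_fun := ((fun t => bump t *: e.1), (fun t => bump t *: e.2)).
have bpC (e : V) : C1dn T (bp e) by split; [exact: bump_C1_rd|exact: bump_C1_ld].
have ba : bump a = 0 by rewrite /bump subrr mul0r.
have bb : bump b = 0 by rewrite /bump subrr mulr0.
have bp0 (e : V) : C1dn0 T (bp e).
  by split => //; rewrite /bp/= ba bb !scale0r.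
have zC := cst_C1dn z.
have [I [[F [dF IF]] [G [dG IG]]]] := sa _ zC (bp k0) (bp h0) (bp0 _) (bp0 _).
pose c := dXform Xq Xp z h0 k0 - dXform Xq Xp z k0 h0.
pose f t := if t \in kappa_dn T then bump t ^+ 2 else 0.
(* The boundary terms cancel all time scale derivatives in [F - G], leaving the Delta-derivative
   [c * f t]. They vanish at both ends, and [F], [G] have the same increment [I], so [L a = L b]. *)
pose L t := F t - G t - L0 (bp k0).1 (bp h0).2 t + L0 (bp h0).1 (bp k0).2 t.
have L0E (u x : V) : L0 (bp u).1 (bp x).2 a = 0 /\ L0 (bp u).1 (bp x).2 b = 0.
  by rewrite /L0/= ba bb !scale0r !dotp0l.
have Lab : L a = L b.
  rewrite /L (L0E k0 h0).1 (L0E k0 h0).2 (L0E h0 k0).1 (L0E h0 k0).2; lra.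
have dL t : kappa_up T t -> is_qderiv T (sigma t) t L (c * f t).
  move=> kt; have [Tt _] := kt.
  have dFt : is_qderiv T (sigma t) t F
      (sympl_integrand ((fun=> z.1), (fun=> z.2)) (bp k0) (bp h0) t).
    by have [/dderivable_qderiv + dE] := dF _ kt; rewrite dE.
  have dGt : is_qderiv T (sigma t) t G
      (sympl_integrand ((fun=> z.1), (fun=> z.2)) (bp h0) (bp k0) t).
    by have [/dderivable_qderiv + dE] := dG _ kt; rewrite dE.
  have [[k1 _] [k2 _]] := bpC k0; have [[h1 _] [h2 _]] := bpC h0.
  have ba2 (e : V) : (bp e).2 a = 0 by rewrite /bp/= ba scale0r.
  have := is_qderivD (is_qderivB (is_qderivB dFt dGt)
    (is_qderiv_dotp_rho hT hab hrho hsigma k1 h2 (ba2 h0) kt))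
    (is_qderiv_dotp_rho hT hab hrho hsigma h1 k2 (ba2 k0) kt).
  congr is_qderiv.
  rewrite (sympl_integrandE _ zC (bpC k0) kt) (sympl_integrandE _ zC (bpC h0) kt).
  rewrite /f; case: ifP => _; last by rewrite mulr0; lra.
  have bE (e e' : V) : dXform Xq Xp (z.1, z.2) ((bp e).1 t, (bp e).2 t)
      ((bp e').1 t, (bp e').2 t) = bump t ^+ 2 * dXform Xq Xp z e e'.
    rewrite -[X in dXform _ _ X]surjective_pairing.
    have bpE (x : V) : ((bp x).1 t, (bp x).2 t) = bump t *: x by [].
    by rewrite !bpE dXformZl dXformZr mulrA expr2.
  have cancel (A B C D s X Y : R) :
      A - B - s * X - (C - D - s * Y) - (A + D) + (C + B) = (Y - X) * s by ring.
  rewrite (bE k0 h0) (bE h0 k0); exact: cancel.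
have f0 t : 0 <= f t by rewrite /f; case: ifP => // _; exact: sqr_ge0.
have kt0 : kappa_up T t0 by exact: kappa_up_lt.
have ft0 : f t0 != 0.
  rewrite /f mem_set; last exact: kappa_dn_lt.
  by rewrite sqrf_eq0 mulf_neq0// subr_eq0 ?gt_eqF.
have cf0 : c * f t0 = 0.
  (* The sign of [c] is unknown; for [c < 0] the argument is applied to [- L]. *)
  have [c0|c0] := leP 0 c.
    apply: (@qderiv_ge0_eq0 L (fun t => c * f t)) => // t kt.
    by split; [exact: dL|exact: mulr_ge0].
  apply/eqP; rewrite -oppr_eq0; apply/eqP.
  apply: (@qderiv_ge0_eq0 (fun t => - L t) (fun t => - (c * f t))) => //.
    by rewrite Lab.
  move=> t kt; split; first exact: is_qderivN (dL _ kt).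
  by rewrite -mulNr mulr_ge0// oppr_ge0 ltW.
by move/eqP: cf0; rewrite mulf_eq0 (negbTE ft0) orbF subr_eq0 => /eqP.
Qed.

End Main.

Theorem theorem32 (R : realType) (T : set R) (d : nat)
    (Xq Xp : 'cV[R]_d * 'cV[R]_d -> 'cV[R]_d)
    (hT : bounded_time_scale T) (hcard : (`I_3 #<= T)%card)
    (hrho : forall t, kappa_up T t -> dderivable T (rho T) t)
    (hsigma : forall t, kappa_dn T t -> nderivable T (sigma T) t)
    (hd : (1 <= d)%N) (hXq : C1_map Xq) (hXp : C1_map Xp) :
  (hamiltonian_vector_field Xq Xp <->
     forall qp : pair_fun, C1dn T qp -> self_adjoint T (opDO T Xq Xp qp)) /\
  (hamiltonian_vector_field Xq Xp ->
     hamiltonian_of Xq Xp (canonicalH Xq Xp)).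
Proof.
have mid := card3_middle hT hcard.
have hab : tmin T < tmax T by case: mid => t _ /andP[]; exact: lt_trans.
have ham_sym : hamiltonian_vector_field Xq Xp -> dXform_symmetric Xq Xp.
  by move=> [H]; exact: hamiltonian_dXform_symmetric.
have sym_ham : dXform_symmetric Xq Xp -> hamiltonian_of Xq Xp (canonicalH Xq Xp).
  move=> sym z i; split.
    have := is_derive_canonicalH hXq hXp z (0, delta_mx i 0) sym.
    by rewrite /Xform dotp0l subr0 dotp_deltal.
  have := is_derive_canonicalH hXq hXp z (delta_mx i 0, 0) sym.
  by rewrite /Xform dotp0l sub0r dotp_deltal.
split; last by move=> /ham_sym/sym_ham.
split=> [/ham_sym sym|sa]; first exact: dXform_symmetric_self_adjoint.
exists (canonicalH Xq Xp); apply: sym_ham.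
exact: (self_adjoint_dXform_symmetric hT hab hrho hsigma hXq hXp mid sa).
Qed.
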